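(* Let $n,m\ge 2$ be integers with $n> m$ and $d=m+n$. Then there exists a real $n\times m$ matrix $\Theta$ which is completely irrational and good and satisfies $R(\Theta)=n+1$.
   Context: Write vectors of $\mathbb{R}^d$ as $\pmb{z}=(\pmb{x},\pmb{y})^\top$ with $\pmb{x}\in\mathbb{R}^m$, $\pmb{y}\in\mathbb{R}^n$. For $\pmb{\xi}\in\mathbb{R}^k$ let $|\pmb{\xi}|=\max_j|\xi_j|$ (sup-norm) and $\|\pmb{\xi}\|=\min_{\pmb{a}\in\mathbb{Z}^k}|\pmb{\xi}-\pmb{a}|$. A linear subspace $\mathcal{R}\subset\mathbb{R}^d$ of dimension $r$ is rational if $\mathcal{R}\cap\mathbb{Z}^d$ is a lattice of rank $r$. The matrix $\Theta$ (equivalently the $m$-dimensional subspace $\mathcal{L}_\Theta=\{\pmb{z}:\pmb{y}=\Theta\pmb{x}\}$) is completely irrational if $\mathcal{L}_\Theta\cap\mathcal{R}=\{\pmb{0}\}$ for every rational subspace $\mathcal{R}$ of dimension $n$. A nonzero integer vector $\pmb{x}\in\mathbb{Z}^m$ is a best approximation for $\Theta$ if $\|\Theta\pmb{x}\|<\|\Theta\pmb{x}'\|$ for all nonzero integer $\pmb{x}'$ with $|\pmb{x}'|\le|\pmb{x}|$, $\pmb{x}'\ne\pm\pmb{x}$; its extended vector is $\pmb{z}=(\pmb{x},\pmb{y})^\top$ where $\pmb{y}\in\mathbb{Z}^n$ satisfies $|\Theta\pmb{x}-\pmb{y}|=\|\Theta\pmb{x}\|$. $\Theta$ is called good if the sequence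 of extended best approximation vectors $\pm\pmb{z}_\nu=\pm(\pmb{x}_\nu,\pmb{y}_\nu)^\top$, $\nu=1,2,\dots$, with $|\pmb{x}_1|<|\pmb{x}_2|<\cdots$ and $\|\Theta\pmb{x}_1\|>\|\Theta\pmb{x}_2\|>\cdots$, is uniquely determined (up to sign of each term). For good $\Theta$, $R(\Theta)$ is the least integer $s$ such that there exist a linear subspace $\mathcal{R}\subset\mathbb{R}^d$ of dimension $s$ and $\nu_0$ with $\pmb{z}_\nu\in\mathcal{R}$ for all $\nu\ge\nu_0$. *)

(* Defs.v *)
From HB Require Import structures.
From mathcomp Require Import all_boot all_order all_algebra.
From mathcomp Require Import all_classical all_reals all_analysis.
From mathcomp Require Import lra.

Set Implicit Arguments.
Unset Strict Implicit.
Unset Printing Implicit Defensive.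

Import Order.TTheory GRing.Theory Num.Theory.
Import numFieldNormedType.Exports.

Local Open Scope classical_set_scope.
Local Open Scope ring_scope.

(* The norm of MathComp-Analysis on 'cV[R]_k is the sup-norm. A vector of
   R^(m+n) is a column z = col_mx x y, with x = usubmx z and y = dsubmx z. *)

Definition intv (R : realType) (k : nat) (a : 'cV[int]_k) : 'cV[R]_k :=
  map_mx intr a.

(* The infimum is a minimum, see dist_int_attained. *)
Definition dist_int (R : realType) (k : nat) (xi : 'cV[R]_k) : R :=
  inf (range (fun a : 'cV[int]_k => `|xi - intv R a|)).

Definition is_lattice (R : realType) (k r : nat) (S : set 'cV[R]_k) : Prop :=
  exists b : r.-tuple 'cV[R]_k, free b /\
    S = range (fun c : 'I_r -> int => \sum_(i < r) (c i)%:~R *: b`_i).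

Definition rational_subspace (R : realType) (k : nat)
    (V : {vspace 'cV[R]_k}) : Prop :=
  is_lattice (\dim V) ([set` V] `&` range (@intv R k)).

Definition graph_subspace (R : realType) (m n : nat) (Theta : 'M[R]_(n, m)) :
    set 'cV[R]_(m + n) :=
  [set z | dsubmx z = Theta *m usubmx z].

Definition completely_irrational (R : realType) (m n : nat)
    (Theta : 'M[R]_(n, m)) : Prop :=
  forall V : {vspace 'cV[R]_(m + n)},
    rational_subspace V -> \dim V = n ->
    graph_subspace Theta `&` [set` V] = [set 0].

Definition best_approximation (R : realType) (m n : nat)
    (Theta : 'M[R]_(n, m)) (x : 'cV[int]_m) : Prop :=
  x <> 0 /\
  forall x' : 'cV[int]_m, x' <> 0 -> `|intv R x'| <= `|intv R x| ->
    x' <> x -> x' <> - x ->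
    dist_int (Theta *m intv R x) < dist_int (Theta *m intv R x').

Definition extended_best_approximation (R : realType) (m n : nat)
    (Theta : 'M[R]_(n, m)) (z : 'cV[int]_(m + n)) : Prop :=
  best_approximation Theta (usubmx z) /\
  `|Theta *m intv R (usubmx z) - intv R (dsubmx z)| =
    dist_int (Theta *m intv R (usubmx z)).

(* The last clause says that no best approximation is omitted. *)
Definition best_approximation_seq (R : realType) (m n : nat)
    (Theta : 'M[R]_(n, m)) (z : nat -> 'cV[int]_(m + n)) : Prop :=
  [/\ forall nu, extended_best_approximation Theta (z nu),
      forall nu, `|intv R (usubmx (z nu))| < `|intv R (usubmx (z nu.+1))|,
      forall nu, dist_int (Theta *m intv R (usubmx (z nu.+1))) <
                 dist_int (Theta *m intv R (usubmx (z nu))) &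
      forall x, best_approximation Theta x ->
        exists nu, usubmx (z nu) = x \/ usubmx (z nu) = - x].

Definition good (R : realType) (m n : nat) (Theta : 'M[R]_(n, m)) : Prop :=
  exists z, best_approximation_seq Theta z /\
    forall z', best_approximation_seq Theta z' ->
      forall nu, z' nu = z nu \/ z' nu = - z nu.

Definition tail_in_dim (R : realType) (k : nat) (z : nat -> 'cV[int]_k)
    (s : nat) : Prop :=
  exists V : {vspace 'cV[R]_k}, \dim V = s /\
    exists nu0 : nat, forall nu, (nu0 <= nu)%N -> intv R (z nu) \in V.

Lemma tail_in_dim_ex (R : realType) (k : nat) (z : nat -> 'cV[int]_k) :
  exists s, `[< tail_in_dim R z s >].
Proof.
exists (\dim {:'cV[R]_k}); apply/asboolP; exists fullv; split=> //.
by exists 0%N => nu _; exact: memvf.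
Qed.

Definition tail_dim (R : realType) (k : nat) (z : nat -> 'cV[int]_k) : nat :=
  ex_minn (tail_in_dim_ex R z).

(* R(Theta). The sequence is picked by choice, and is the zero sequence when
   there is none; for good Theta the choice is immaterial, see best_dimE. *)
Definition best_dim (R : realType) (m n : nat) (Theta : 'M[R]_(n, m)) : nat :=
  tail_dim R (xget (fun=> 0) (best_approximation_seq Theta)).

Lemma tail_in_dim_sign (R : realType) (k : nat) (z z' : nat -> 'cV[int]_k) :
  (forall nu, z' nu = z nu \/ z' nu = - z nu) ->
  tail_in_dim R z = tail_in_dim R z'.
Proof.
move=> zz'; apply/funext => s; apply/propext.
have memE (V : {vspace 'cV[R]_k}) nu :
    (intv R (z' nu) \in V) = (intv R (z nu) \in V).
  by case: (zz' nu) => ->//; rewrite /intv map_mxN memvN.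
split=> -[V [dV [nu0 Vz]]]; exists V; split=> //; exists nu0 => nu /Vz;
  by rewrite memE.
Qed.

Lemma best_dimE (R : realType) (m n : nat) (Theta : 'M[R]_(n, m)) z :
  good Theta -> best_approximation_seq Theta z ->
  best_dim Theta = tail_dim R z.
Proof.
move=> [z0 [z0P uz0]] zP; rewrite /best_dim.
have /uz0 wz0 := xgetPex (fun=> 0) (ex_intro _ _ z0P).
have /uz0 zz0 := zP.
have eq_tail := etrans (esym (tail_in_dim_sign R wz0)) (tail_in_dim_sign R zz0).
rewrite /tail_dim; case: ex_minnP => s /asboolP sP smin.
case: ex_minnP => t /asboolP tP tmin.
apply/eqP; rewrite eqn_leq smin ?tmin//; apply/asboolP.
- by rewrite -eq_tail.
- by rewrite eq_tail.
Qed.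

Lemma nearest_int (R : realType) (x : R) :
  {a : int | forall b : int, `|x - a%:~R| <= `|x - b%:~R|}.
Proof.
exists (Num.floor (x + 2^-1)) => b.
have /andP[] := floor_itv (x + 2^-1).
set a := Num.floor _; rewrite intrD => le1 le2.
have [ab|ba|->//] := ltgtP a b.
- have : (a + 1)%:~R <= b%:~R :> R by rewrite ler_int lezD1.
  rewrite intrD => h.
  have -> : `|x - b%:~R| = b%:~R - x by rewrite distrC ger0_norm//; lra.
  by rewrite ler_norml; apply/andP; split; lra.
- have : (b + 1)%:~R <= a%:~R :> R by rewrite ler_int lezD1.
  rewrite intrD => h.
  have -> : `|x - b%:~R| = x - b%:~R by rewrite ger0_norm//; lra.
  by rewrite ler_norml; apply/andP; split; lra.
Qed.

Lemma dist_int_attained (R : realType) (k : nat) (xi : 'cV[R]_k) :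
  exists a : 'cV[int]_k, dist_int xi = `|xi - intv R a|.
Proof.
exists (\col_i sval (nearest_int (xi i 0))).
apply/eqP; rewrite eq_le; apply/andP; split.
  apply: ge_inf; first by exists 0 => _ [a _ <-]; exact: normr_ge0.
  by exists (\col_i sval (nearest_int (xi i 0))).
apply: lb_le_inf; first by exists `|xi - intv R 0|, 0.
move=> _ [a _ <-].
rewrite [leLHS]/Num.Def.normr/= mx_normrE bigmax_le// => -[i j] _ /=.
apply: (@le_trans _ _ `|(xi - intv R a) i j|); last first.
  rewrite [leRHS]/Num.Def.normr/= mx_normrE.
  by rewrite (le_bigmax _ (fun ij => `|(xi - intv R a) ij.1 ij.2|) (i, j)).
rewrite !mxE (ord1 j); case: nearest_int => b /= bP; exact: bP.
Qed.

(* Main.v *)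
Require Import Defs.
From mathcomp Require Import all_boot all_order all_algebra.
From mathcomp Require Import all_classical all_reals all_analysis.
From mathcomp Require Import lra zify ring.

Set Implicit Arguments.
Unset Strict Implicit.
Unset Printing Implicit Defensive.

Import Order.TTheory GRing.Theory Num.Theory.
Import numFieldNormedType.Exports.

Local Open Scope ring_scope.

(** Write [Theta] as its first column [t] followed by a block [T'], and let [S] be
the rational subspace of dimension [n + 1] on which only the first [x]-coordinate
and the [y]-coordinates survive. The column [t] is built as a limit of rational
points [p_k / q_k], each obtained from the previous one by a displacement of
order [1 / q_{k+1}], so that [t] satisfies [||q_k t|| <= eta_k] with [eta_k] of
order [1 / q_{k+1}] (the constants depend on [q_k], and [q_{k+1}] is chosen last). The integer points [x] outside the first axis with
[|x| <= q_{k+1}] number about [q_{k+1}^m], and each of them satisfies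
[||Theta x|| <= eta_k] on a set of matrices of measure of order [q_{k+1}^{-n}]. As
[m < n], some [T'] near the previous one makes all of them worse than [q_k]
times the first basis vector. Hence every large best approximation lies in [S].
Complete irrationality is a countable family of conditions [det <> 0], one of
which is inserted at each step of the construction; it gives the uniqueness of
the extended vectors, and it prevents their tail from lying in dimension [n],
since a rational subspace [V] of dimension [n] complementary to the graph meets a
bounded neighbourhood of the graph in a bounded set. *)

(** * Averaging over a grid *)

Lemma size_int_interval (R : realType) (A : seq int) (c L : R) : 0 <= L ->
  uniq A -> (forall u, u \in A -> `|u%:~R - c| <= L) ->
  (size A)%:R <= 2 * L + 1.
Proof.
move=> L0 uA AL; set lo := Num.ceil (c - L); set hi := Num.floor (c + L).
have lohi u : u \in A -> lo <= u <= hi.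
  move=> /AL; rewrite ler_norml => /andP[h1 h2].
  by rewrite ceil_le_int floor_ge_int; apply/andP; split; lra.
case: A uA AL lohi => [|u0 A] uA AL lohi; first by rewrite /=; lra.
have /andP[l0 h0] := lohi u0 (mem_head _ _).
have sz : (size (u0 :: A) <= `|hi - lo|.+1)%N.
  rewrite -(size_map (fun u => `|u - lo|%N)) -[X in (_ <= X)%N](size_iota 0).
  apply: uniq_leq_size.
    rewrite map_inj_in_uniq// => u v /lohi/andP[a b] /lohi/andP[a' b'] e.
    by lia.
  move=> _ /mapP[u /lohi/andP[a b] ->]; rewrite mem_iota; lia.
have : (hi - lo)%:~R <= 2 * L :> R.
  rewrite intrB; have := floor_le (c + L); have := ceil_ge (c - L).
  by rewrite -/lo -/hi; lra.
have -> : hi - lo = `|hi - lo|%N%:Z by lia.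
move=> h; apply: (@le_trans _ _ (`|hi - lo|.+1)%:R); first by rewrite ler_nat.
by rewrite -natr1 lerD2r (le_trans _ h)// -pmulrn.
Qed.

(** Boolean-valued, so that bad points and bad samples can be counted. *)
Definition near_int (R : realType) (d x : R) : bool :=
  `[< exists y : int, `|x - y%:~R| <= d >].

(* Mapping a bad sample [i] to [s * i - N * M * y], with [y] the integer close to
   its value, is injective, as [N] is a prime not dividing [s], and its values lie
   in an interval of length [2 * (N * M * d)]. *)
Lemma count_near_int (R : realType) (N M : nat) (s : int) (a c d : R) :
  prime N -> (0 < M)%N -> s != 0 -> (`|s| < N)%N -> 0 <= d ->
  (#|[pred i : 'I_N | near_int d (s%:~R * (a + i%:R / (M * N)%:R) + c)]|)%:R
    <= 2 * (N%:R * M%:R * d) + 1.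
Proof.
move=> pN M0 s0 sN d0; set P := [pred i | _].
have N0 : (0 < N)%N by apply: prime_gt0.
have Nn0 : N%:R != 0 :> R by rewrite pnatr_eq0; lia.
have Mn0 : M%:R != 0 :> R by rewrite pnatr_eq0; lia.
pose y (i : 'I_N) : int := xget 0%Z [set y : int |
  `|s%:~R * (a + i%:R / (M * N)%:R) + c - y%:~R| <= d]%classic.
have yP i : P i -> `|s%:~R * (a + i%:R / (M * N)%:R) + c - (y i)%:~R| <= d.
  by move=> /asboolP ex; have := xgetPex 0%Z ex.
pose u (i : 'I_N) := (s * i%:Z - N%:Z * M%:Z * y i)%R.
rewrite cardE -(size_map u).
apply: (@size_int_interval _ _ (- (N%:R * M%:R) * (s%:~R * a + c))).
- by rewrite !mulr_ge0.
- rewrite map_inj_in_uniq ?enum_uniq// => i j _ _ /eqP.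
  rewrite /u => e; apply/val_inj => /=.
  have dv : (N%:Z %| s * (i%:Z - j%:Z))%Z.
    apply/dvdzP; exists (M%:Z * (y i - y j)).
    move/eqP: e => e; lia.
  move: dv; rewrite dvdzE abszM/= Euclid_dvdM// => /orP[].
    by move/dvdn_leq; rewrite absz_gt0 s0 => /(_ isT); lia.
  have ltij : (`|i%:Z - j%:Z| < N)%N by have := ltn_ord i; have := ltn_ord j; lia.
  have [->//|ne] := eqVneq (nat_of_ord i) (nat_of_ord j).
  move/dvdn_leq; have -> : (0 < `|i%:Z - j%:Z|)%N by lia.
  by move=> /(_ isT); lia.
move=> _ /mapP[i iP ->]; rewrite mem_enum in iP; have h := yP _ iP.
have -> : (u i)%:~R - - (N%:R * M%:R) * (s%:~R * a + c) = (N%:R * M%:R) *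
  (s%:~R * (a + i%:R / (M * N)%:R) + c - (y i)%:~R).
  rewrite natrM /u intrB !intrM -!pmulrn; field.
  by rewrite Nn0 Mn0.
by rewrite normrM ger0_norm ?mulr_ge0// ler_wpM2l// mulr_ge0.
Qed.

(** Double counting over the [N] samples [a + i / (M * N)]: each [x] is bad for at most
    [2 * N * M * d + 1] of them, so some sample is bad for at most the average proportion of [X]. *)
Lemma exists_few_near_int (R : realType) (T : eqType) (X : seq T) (s : T -> int)
    (c : T -> R) (N M : nat) (a d : R) :
  prime N -> (0 < M)%N -> 0 <= d ->
  (forall x, x \in X -> s x != 0 /\ (`|s x| < N)%N) ->
  exists t, `|t - a| <= M%:R^-1 /\
    (count (fun x => near_int d ((s x)%:~R * t + c x)) X)%:R <=
      (2 * M%:R * d + N%:R^-1) * (size X)%:R.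
Proof.
move=> pN M0 d0 sX.
have N0 : 0 < N%:R :> R by rewrite ltr0n prime_gt0.
have M0' : 0 < M%:R :> R by rewrite ltr0n.
set p := 2 * M%:R * d + N%:R^-1.
pose t (i : 'I_N) : R := a + i%:R / (M * N)%:R.
pose cnt i := count (fun x => near_int d ((s x)%:~R * t i + c x)) X.
suff [i hi] : exists i, (cnt i)%:R <= p * (size X)%:R.
  exists (t i); split=> //; rewrite /t addrC addKr natrM invfM mulrCA.
  rewrite ger0_norm ?mulr_ge0 ?invr_ge0// ler_piMr ?invr_ge0//.
  by rewrite ler_pdivrMr// mul1r ler_nat ltnW.
apply/existsP; rewrite -[X in is_true X]negbK negb_exists; apply/negP => /forallP h.
have : \sum_i (cnt i)%:R > \sum_(i < N) (p * (size X)%:R).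
  apply: ltr_sum => //; last by move=> i _; rewrite ltNge h.
  by apply/hasP; exists (Ordinal (prime_gt0 pN)); rewrite ?mem_index_enum.
apply/negP; rewrite -leNgt sumr_const card_ord -natr_sum /cnt.
under eq_bigr do rewrite -sum1_count big_mkcond/=.
rewrite exchange_big/= natr_sum.
under eq_bigr do rewrite -big_mkcond/= sum1_card.
rewrite -mulrnAl.
apply: (@le_trans _ _ (\sum_(x <- X) (p *+ N))); last first.
  by rewrite big_const_seq count_predT iter_addr_0 mulr_natr.
rewrite !big_seq; apply: ler_sum => x /sX [sx0 sxN].
apply: le_trans (count_near_int a (c x) pN M0 sx0 sxN d0) _.
rewrite -(mulr_natr p N) /p; set z := N%:R^-1.
have : N%:R * z = 1 by rewrite divff// gt_eqF.
move=> e; have -> : (2 * M%:R * d + z) * N%:R = 2 * (N%:R * M%:R * d) + N%:R * z.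
  by ring.
by rewrite e.
Qed.

(* The entries of the column are chosen one after the other, each of them keeping
   at most a proportion [2 * M * d + 1 / N] of the surviving elements of [X]. *)
Lemma exists_column (R : realType) (T : eqType) (X : seq T) (s : T -> int)
    (c : T -> nat -> R) (N M n : nat) (a : nat -> R) (d : R) :
  prime N -> (0 < M)%N -> 0 <= d ->
  (forall x, x \in X -> s x != 0 /\ (`|s x| < N)%N) ->
  (2 * M%:R * d + N%:R^-1) ^+ n * (size X)%:R < 1 ->
  exists t : nat -> R, (forall i, `|t i - a i| <= M%:R^-1) /\
    forall x, x \in X -> exists2 i, (i < n)%N &
      ~~ near_int d ((s x)%:~R * t i + c x i).
Proof.
move=> pN M0 d0 sX; set p := 2 * M%:R * d + N%:R^-1 => small.
pose bad t x i := near_int d ((s x)%:~R * (t i : R) + c x i).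
have p0 : 0 <= p by rewrite /p addr_ge0 ?invr_ge0// !mulr_ge0.
have [t [ta ht]] : exists t : nat -> R, (forall i, `|t i - a i| <= M%:R^-1) /\
    (count (fun x => all (bad t x) (iota 0 n)) X)%:R <= p ^+ n * (size X)%:R.
  elim: n {small} => [|n [t [ta IH]]].
    exists a; split; first by move=> i; rewrite subrr normr0 invr_ge0.
    by rewrite expr0 mul1r ler_nat count_size.
  set P := (fun _ => _) in IH.
  have sX' x : x \in seq.filter P X -> s x != 0 /\ (`|s x| < N)%N.
    by rewrite mem_filter => /andP[_ /sX].
  have [u [ua hu]] := exists_few_near_int (c ^~ n) (a n) pN M0 d0 sX'.
  exists (fun i => if i == n then u else t i); split.
    by move=> i; case: eqP => [->//|_].
  rewrite -/p in hu; rewrite exprS -mulrA.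
  apply: le_trans _ (le_trans hu _); last first.
    by rewrite ler_wpM2l// size_filter.
  rewrite ler_nat count_filter; apply: sub_count => x.
  have -> : iota 0 n.+1 = rcons (iota 0 n) n by rewrite -cats1 -(iotaD 0 n 1) addn1.
  rewrite all_rcons => /andP[h2 h1].
  apply/andP; split; first by move: h2; rewrite /bad eqxx.
  apply/allP => i iin; have := allP h1 _ iin; rewrite /bad ifN//.
  by move: iin; rewrite mem_iota; lia.
exists t; split=> // x xX.
have : count (fun x => all (bad t x) (iota 0 n)) X = 0%N.
  apply/eqP; rewrite -leqn0 -ltnS -(ltr_nat R).
  exact: le_lt_trans ht small.
move/eqP; rewrite -leqn0 leqNgt -has_count => /hasPn/(_ _ xX).
by move=> /allPn[i]; rewrite mem_iota => /= ? ?; exists i.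
Qed.

(** * Matrices that are badly approximable off the first axis *)

Definition int_box (m Q : nat) : seq 'cV[int]_m :=
  [seq (\col_j ((w j : nat)%:Z - Q%:Z))%R | w : {ffun 'I_m -> 'I_(2 * Q).+1}].

Lemma size_int_box m Q : size (int_box m Q) = ((2 * Q).+1 ^ m)%N.
Proof. by rewrite size_map -cardE card_ffun !card_ord. Qed.

Lemma mem_int_box m Q (x : 'cV[int]_m) :
  reflect (forall j, (`|x j 0%R| <= Q)%N) (x \in int_box m Q).
Proof.
apply: (iffP mapP) => [[w _ ->] j|h].
  by rewrite mxE; move: (w j) (ltn_ord (w j)) => [z /= _] hz; lia.
exists [ffun j => inord `|(x j 0 + Q%:Z)%R|%N]; first by rewrite mem_enum.
apply/colP => j; rewrite !mxE ffunE inordK; move: (x j 0) (h j) => z; lia.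
Qed.

(** The box holds at most [(3 Q)^(m+1)] points, and a column is bad for a proportion at most
    [(C / Q)^n] of them. As [n > m + 1], the product is below 1 for large [Q], and [exists_column]
    applies to each column after the first. *)
Lemma exists_badly_approximable (R : realType) (n m M : nat) (K : R) :
  (m.+1 < n)%N -> (0 < M)%N -> 0 <= K ->
  exists Q0 : nat, forall Q, (Q0 <= Q)%N -> forall Theta0 : 'M[R]_(n, m.+1),
  exists Theta : 'M[R]_(n, m.+1),
  [/\ forall i, Theta i 0 = Theta0 i 0,
      forall i j, `|Theta i j - Theta0 i j| <= M%:R^-1 &
      forall x : 'cV[int]_m.+1, (forall j, (`|x j 0%R| <= Q)%N) ->
        (exists2 j : 'I_m.+1, j != 0 & x j 0 != 0) ->
        exists i, ~~ near_int (K / Q%:R) ((Theta *m intv R x) i 0)].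
Proof.
move=> mn M0 K0; set C := 2 * M%:R * K + 1.
have C0 : 0 <= C by rewrite addr_ge0// !mulr_ge0.
exists (Num.bound (C ^+ n * 3 ^+ m.+1)).+1 => Q Qbig Theta0.
have Q0 : (0 < Q)%N by apply: leq_trans Qbig.
have Q0R : 0 < Q%:R :> R by rewrite ltr0n.
(* A prime above [Q] divides no nonzero coordinate of a point of the box, and [1 / N <= 1 / Q]. *)
have [N QN pN] := prime_above Q.
set d := K / Q%:R.
have d0 : 0 <= d by rewrite divr_ge0.
have p0 : 0 <= 2 * M%:R * d + N%:R^-1 by rewrite addr_ge0 ?invr_ge0// !mulr_ge0.
have small : (2 * M%:R * d + N%:R^-1) ^+ n * ((2 * Q).+1 ^ m.+1)%:R < 1.
  have h1 : (2 * M%:R * d + N%:R^-1) ^+ n <= (C / Q%:R) ^+ n.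
    apply: lerXn2r; rewrite ?nnegrE ?divr_ge0//.
    have -> : C / Q%:R = 2 * M%:R * d + Q%:R^-1 by rewrite /C /d; ring.
    rewrite lerD2l lef_pV2 ?posrE ?ltr0n ?(prime_gt0 pN)//.
    by rewrite ler_nat ltnW.
  have h2 : ((2 * Q).+1 ^ m.+1)%:R <= (3 * Q%:R) ^+ m.+1 :> R.
    rewrite -natrM -natrX ler_nat leq_exp2r//; lia.
  apply: le_lt_trans (ler_pM _ _ h1 h2) _; rewrite ?exprn_ge0//.
  have -> : n = (m.+1 + (n - m.+2).+1)%N by lia.
  set e := (n - m.+2)%N.
  have -> : (C / Q%:R) ^+ (m.+1 + e.+1) * (3 * Q%:R) ^+ m.+1 =
    (C ^+ (m.+1 + e.+1) * 3 ^+ m.+1) / Q%:R ^+ e.+1.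
    rewrite !exprMn exprVn (exprD Q%:R) invfM.
    have : Q%:R ^+ m.+1 != 0 :> R by rewrite expf_neq0// gt_eqF.
    have : Q%:R ^+ e.+1 != 0 :> R by rewrite expf_neq0// gt_eqF.
    by move=> *; field; apply/andP; split.
  have -> : (m.+1 + e.+1)%N = n by rewrite /e; lia.
  rewrite ltr_pdivrMr ?exprn_gt0// mul1r.
  apply: (@lt_le_trans _ _ Q%:R).
    apply: lt_le_trans (archi_boundP _) _; first by rewrite mulr_ge0 ?exprn_ge0.
    by rewrite ler_nat ltnW.
  by rewrite -natrX ler_nat -[X in (X <= _)%N]expn1 leq_pexp2l.
(* Induction on the last coordinate that may be nonzero: column [l + 1] is chosen for the points
   whose coordinate [l + 1] is nonzero, once the earlier columns are fixed. *)
suff: forall l, (l <= m)%N -> exists Theta : 'M[R]_(n, m.+1),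
  [/\ forall i, Theta i 0 = Theta0 i 0,
      forall i j, `|Theta i j - Theta0 i j| <= M%:R^-1 &
      forall x : 'cV[int]_m.+1, (forall j, (`|x j 0%R| <= Q)%N) ->
        (forall j : 'I_m.+1, (l < j)%N -> x j 0 = 0) ->
        (exists2 j : 'I_m.+1, j != 0 & x j 0 != 0) ->
        exists i, ~~ near_int d ((Theta *m intv R x) i 0)].
  move=> /(_ m (leqnn m)) [Th [h1 h2 h3]]; exists Th; split=> // x xQ xn0.
  by apply: h3 => // j; have := ltn_ord j; lia.
elim=> [_|l IH lm].
  exists Theta0; split=> // [i j|x xQ xl [j j0]].
    by rewrite subrr normr0 invr_ge0.
  by rewrite xl ?eqxx// lt0n.
have [Th [h1 h2 h3]] := IH (ltnW lm).
pose L : 'I_m.+1 := Ordinal (lm : (l.+1 < m.+1)%N).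
pose X := [seq x : 'cV[int]_m.+1 <- int_box m.+1 Q | x L 0 != 0].
pose s (x : 'cV[int]_m.+1) := x L 0.
(* [exists_column] numbers the rows by [nat]; indices from [n] on get the default 0. *)
pose c (x : 'cV[int]_m.+1) (i : nat) : R :=
  if insub i is Some i' then \sum_(j | j != L) Th i' j * (x j 0)%:~R else 0.
pose a i : R := if insub i is Some i' then Theta0 i' L else 0.
have sX x : x \in X -> s x != 0 /\ (`|s x| < N)%N.
  rewrite mem_filter => /andP[-> /mem_int_box/(_ L)]; rewrite /s => h.
  by split=> //; exact: leq_ltn_trans QN.
have smallX : (2 * M%:R * d + N%:R^-1) ^+ n * (size X)%:R < 1.
  apply: le_lt_trans small; rewrite ler_wpM2l ?exprn_ge0// ler_nat.
  by rewrite -size_int_box size_filter count_size.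
have [t [ta ht]] := exists_column c a pN M0 d0 sX smallX.
exists (\matrix_(i, j) if j == L then t i else Th i j); split.
- by move=> i; rewrite mxE; case: eqP => // /(congr1 val).
- move=> i j; rewrite mxE; case: eqP => [->|_//].
  by have := ta i; rewrite /a valK.
move=> x xQ xl xn0.
have E i : ((\matrix_(i, j) if j == L then t i else Th i j) *m intv R x) i 0
    = (x L 0)%:~R * t i + \sum_(j | j != L) Th i j * (x j 0)%:~R.
  rewrite mxE (bigD1 L)//= !mxE eqxx mulrC; congr (_ + _).
  by apply: eq_bigr => j jL; rewrite !mxE (negbTE jL).
(* The new column does not act on points with [x L 0 = 0], so for them the induction hypothesis
   persists. *)
have [xL0|xL] := eqVneq (x L 0) 0.
  have [j|//|i hi] := h3 x xQ; last first.
    exists i; rewrite E; move: hi; rewrite mxE (bigD1 L)//= !mxE xL0 !mulr0 mul0r.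
    by under eq_bigr do rewrite mxE.
  rewrite leq_eqVlt => /orP[/eqP e|]; last exact: xl.
  by have -> : j = L by apply/val_inj.
have [|i i_n hi] := ht x.
  by rewrite mem_filter xL; apply/mem_int_box.
by exists (Ordinal i_n); rewrite E; move: hi; rewrite /c insubT /=.
Qed.

(** * Determinants detecting complete irrationality *)

(** [X] is injective on the left kernel [N] of [P], so [N *m X] has a right inverse [Y]. With [T]
    spanning a complement of the row space of [P], the correction [X *m (Y *m T)] maps the kernel
    isomorphically onto that complement. *)
Lemma exists_add_mulmx_unit (F : fieldType) (m n : nat) (P : 'M[F]_n)
    (X : 'M[F]_(n, m)) :
  (forall v : 'rV_n, v *m P = 0 -> v *m X = 0 -> v = 0) ->
  exists U : 'M[F]_(m, n), P + X *m U \in unitmx.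
Proof.
move=> PX.
have [N fN NE] : exists2 N : 'M[F]_(\rank (kermx P), n),
    row_free N & (N :=: kermx P)%MS.
  by exists (row_base (kermx P)); [exact: row_base_free|exact: eq_row_base].
have NP : N *m P = 0 by apply/sub_kermxP; rewrite NE.
have [Y NXY] : exists Y, (N *m X) *m Y = 1%:M.
  apply/row_freeP; rewrite -kermx_eq0; apply/rowV0P => v /sub_kermxP.
  rewrite mulmxA => vNX.
  have : v *m N = 0 by apply: PX => //; rewrite -mulmxA NP mulmx0.
  move=> vN; apply: (row_free_inj fN).
  by rewrite vN mul0mx.
have [T [fT PT]] : exists T : 'M[F]_(\rank (kermx P), n),
    row_free T /\ (P :&: T)%MS = 0.
  rewrite mxrank_ker -mxrank_compl; exists (row_base P^C%MS).
  rewrite row_base_free; split=> //; apply/eqP.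
  by rewrite -submx0 (cap_eqmx (eqmx_refl _) (eq_row_base _)) capmx_compl.
exists (Y *m T); rewrite -row_free_unit -kermx_eq0.
apply/rowV0P => v /sub_kermxP; rewrite mulmxDr => /eqP; rewrite addr_eq0 => /eqP e.
have vP : v *m P = 0.
  apply/eqP; rewrite -submx0 -PT sub_capmx submxMl e -mulNmx !mulmxA.
  exact: submxMl.
have /submxP[c vN] : (v <= N)%MS by rewrite NE; apply/sub_kermxP.
move: e; rewrite vP => /eqP; rewrite eq_sym oppr_eq0 => /eqP e.
have cT : c *m T = 0 by rewrite -[c]mulmx1 -NXY -!mulmxA (mulmxA c) -vN.
by rewrite vN (_ : c = 0) ?mul0mx//; apply: (row_free_inj fT); rewrite cT mul0mx.
Qed.

Definition full_col_rank (R : realType) (k n : nat) (B : 'M[int]_(k, n)) : Prop :=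
  forall c : 'cV[R]_n, map_mx intr B *m c = 0 -> c = 0.

(* For [B] of full column rank: nonzero iff the graph of [Theta] meets the column
   space of [B] trivially. *)
Definition graph_det (R : realType) (m n : nat) (B : 'M[int]_(m + n, n))
    (Theta : 'M[R]_(n, m)) : R :=
  \det (map_mx intr (dsubmx B) - Theta *m map_mx intr (usubmx B)).

(** Full column rank says that the two blocks of [B] have no common kernel, which is the hypothesis
    of [exists_add_mulmx_unit] after transposition. *)
Lemma exists_graph_det_neq0 (R : realType) (m n : nat) (B : 'M[int]_(m + n, n)) :
  full_col_rank R B -> exists Theta : 'M[R]_(n, m), graph_det B Theta != 0.
Proof.
move=> fB.
have [|U hU] := @exists_add_mulmx_unit R m n (map_mx intr (dsubmx B))^T
    (map_mx intr (usubmx B))^T.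
  move=> v vd vu; apply/trmx_inj; rewrite trmx0; apply: fB.
  rewrite -[B]vsubmxK map_col_mx mul_col_mx.
  apply/eqP; rewrite col_mx_eq0; apply/andP; split; apply/eqP/trmx_inj;
  by rewrite trmx_mul trmxK trmx0.
exists (- U^T); rewrite /graph_det -unitfE -unitmxE -unitmx_tr.
by rewrite linearB/= trmx_mul linearN/= trmxK mulmxN opprK.
Qed.

(** Write [p = X^m q] with [q.[0] != 0] and use the continuity of [q]. Along a segment, this gives
    arbitrarily small moves that make a determinant nonzero. *)
Lemma poly_neq0_near0 (R : realType) (p : {poly R}) : p.[1] != 0 ->
  exists2 e : R, 0 < e & forall t, 0 < t < e -> p.[t] != 0.
Proof.
move=> p1.
have [m [q /implyP q0 pE]] := multiplicity_XsubC p 0.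
have {}q0 : q.[0] != 0.
  by apply: q0; apply: contraNneq p1 => ->; rewrite horner0.
have : nbhs (0 : R) (fun t => q.[t] != 0).
  exact: cvgr_neq0 (@continuous_horner R q 0) q0.
move=> /nbhs_ballP[e e0 He].
exists e => // t /andP[t0 te]; rewrite pE hornerM horner_exp !hornerE.
rewrite mulf_neq0 ?expf_neq0 ?subr0 ?(gt_eqF t0)//; apply: He.
by rewrite -ball_normE/= sub0r normrN gtr0_norm.
Qed.

Lemma graph_det_line (R : realType) (m n : nat) (B : 'M[int]_(m + n, n))
    (Theta D : 'M[R]_(n, m)) :
  exists p : {poly R}, forall t, p.[t] = graph_det B (Theta + t *: D).
Proof.
set B1 := map_mx intr (usubmx B) : 'M[R]_(m, n).
set B2 := map_mx intr (dsubmx B) : 'M[R]_n.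
exists (\det (map_mx polyC (B2 - Theta *m B1) - 'X *: map_mx polyC (D *m B1))).
move=> t; rewrite -[LHS]/(horner_eval t _) -det_map_mx /graph_det -/B1 -/B2.
rewrite mulmxDl -scalemxAl opprD addrA.
move: (B2 - _) (D *m B1) => A C; congr (\det _); apply/matrixP => i j.
rewrite !mxE -[LHS]/(horner _ _).
by rewrite !hornerE.
Qed.

Lemma continuous_det (R : realType) (U : topologicalType) (n : nat)
    (M : U -> 'M[R]_n) :
  (forall i j, continuous (fun x => M x i j)) -> continuous (fun x => \det (M x)).
Proof.
move=> ctM x; apply: cvg_big => [|s _]; first exact: add_continuous.
apply: cvgM; first exact: cvg_cst.
by apply: cvg_big => [|i _]; [exact: mul_continuous|exact: ctM].
Qed.

Lemma graph_det_neq0_near (R : realType) (m n : nat) (B : 'M[int]_(m + n, n))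
    (Theta : 'M[R]_(n, m)) : graph_det B Theta != 0 ->
  exists2 e : R, 0 < e & forall Theta' : 'M[R]_(n, m),
    (forall i j, `|Theta' i j - Theta i j| <= e) -> graph_det B Theta' != 0.
Proof.
move=> h.
have ctd : continuous (@graph_det R m n B).
  rewrite /graph_det; move: (map_mx _ _) (map_mx _ _) => C A.
  apply: continuous_det => i j.
  rewrite [X in continuous X](_ : _ = fun x : 'M[R]_(n, m) => A i j - \sum_k x i k * C k j).
    move=> T; apply: continuousB; first exact: cst_continuous.
    suff: continuous (fun x : 'M[R]_(n, m) => \sum_k x i k * C k j) by apply.
    apply: continuous_big => [|k _ {}T]; first exact: add_continuous.
    apply: continuousM; last exact: cst_continuous.
    exact: coord_continuous.
  by apply/funext => x; rewrite !mxE.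
have nT : nbhs Theta (fun T => graph_det B T != 0).
  exact: cvgr_neq0 (ctd Theta) h.
have [e e0 He] := (nbhs_ballP _ _).1 nT.
(* Halving turns the open ball into a closed neighbourhood. *)
exists (e / 2); first by rewrite divr_gt0.
move=> T' hT'; apply: He; split=> [//|i j]; rewrite -ball_normE/= distrC.
by apply: le_lt_trans (hT' i j) _; rewrite ltr_pdivrMr// ltr_pMr// ltr1n.
Qed.

(** * The inductive construction *)

Lemma not_near_int_perturb (R : realType) (n m Q : nat) (T T' : 'M[R]_(n, m))
    (x : 'cV[int]_m) (i : 'I_n) (e d d' : R) :
  (forall j, `|T' i j - T i j| <= e) -> (forall j, (`|x j 0%R| <= Q)%N) ->
  d' + m%:R * (e * Q%:R) <= d ->
  ~~ near_int d ((T *m intv R x) i 0) -> ~~ near_int d' ((T' *m intv R x) i 0).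
Proof.
move=> TT' xQ dd'; apply: contraNN => /asboolP[y yP]; apply/asboolP; exists y.
apply: le_trans dd'; rewrite [leRHS]addrC.
have -> : (T *m intv R x) i 0 - y%:~R = ((T *m intv R x) i 0 -
  (T' *m intv R x) i 0) + ((T' *m intv R x) i 0 - y%:~R) by ring.
apply: le_trans (ler_normD _ _) (lerD _ yP).
rewrite !mxE -sumrB; apply: le_trans (ler_norm_sum _ _ _) _.
apply: le_trans (ler_sum _ (G := fun=> e * Q%:R) _) _; last first.
  by rewrite sumr_const card_ord mulr_natl.
move=> j _; rewrite !mxE -mulrBl normrM distrC ler_pM//.
by rewrite -intr_norm -abszE -pmulrn ler_nat.
Qed.

Section Step.
Variables (R : realType) (n m : nat).
Hypothesis mn : (m.+1 < n)%N.
Implicit Types Theta : 'M[R]_(n, m.+1).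

Definition mx_close (d : R) Theta Theta' := forall i j,
  `|Theta' i j - Theta i j| <= d.

(** Rounding the first column of [Th0 - Theta] to multiples of [1 / k] keeps [g] nonzero. Small
    rational multiples of [D] then preserve the rationality of the first column. *)
Lemma exists_shift_rational (g : 'M[R]_(n, m.+1) -> R) Theta :
  (exists Theta0, g Theta0 != 0) ->
  (forall Theta, g Theta != 0 ->
    exists2 e, 0 < e & forall Theta', mx_close e Theta Theta' -> g Theta' != 0) ->
  exists (D : 'M[R]_(n, m.+1)) (w : 'I_n -> int) (k : nat),
    [/\ (0 < k)%N, forall i, D i 0 = (w i)%:~R / k%:R & g (Theta + D) != 0].
Proof.
move=> [Th0 g0] /(_ _ g0)[e e0 He].
pose k := (Num.bound e^-1).+1.
have ke : k%:R^-1 <= e.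
  rewrite invf_ple ?posrE// ltW// (lt_trans (archi_boundP _))//.
    by rewrite ltW// invr_gt0.
  by rewrite ltr_nat.
pose w i := Num.floor (k%:R * (Th0 i 0 - Theta i 0)).
exists (\matrix_(i, j) if j == 0 then (w i)%:~R / k%:R else Th0 i j - Theta i j), w, k.
split=> // [i|]; first by rewrite mxE.
apply: He => i j; rewrite !mxE; case: eqP => [->|_]; last first.
  by rewrite addrC subrK subrr normr0 ltW.
apply: le_trans ke.
have /andP[] := floor_itv (k%:R * (Th0 i 0 - Theta i 0)); rewrite -/(w i).
rewrite intrD => h1 h2.
have k0 : 0 < k%:R :> R by rewrite ltr0n.
rewrite -(ler_pM2l k0) divff ?gt_eqF// -{1}(ger0_norm (ltW k0)) -normrM.
have -> : k%:R * (Theta i 0 + (w i)%:~R / k%:R - Th0 i 0) =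
    (w i)%:~R - k%:R * (Th0 i 0 - Theta i 0).
  by field; rewrite gt_eqF.
by rewrite ler_norml; apply/andP; split; lra.
Qed.

(** Three moves lead to [Theta1]: a small multiple of [D], with rational first column and [g]
    nonzero; a change of the other columns that makes the points off the axis bad; a small move back
    that makes [g] nonzero again. The conclusions hold on a whole ball, hence for the limit. *)
Lemma exists_step (g : 'M[R]_(n, m.+1) -> R) Theta (rho : R) (q : nat) :
  (exists Theta0, g Theta0 != 0) ->
  (forall Theta D, exists p : {poly R}, forall t, p.[t] = g (Theta + t *: D)) ->
  (forall Theta, g Theta != 0 ->
    exists2 e, 0 < e & forall Theta', mx_close e Theta Theta' -> g Theta' != 0) ->
  0 < rho -> (0 < q)%N -> (forall i, exists p : int, q%:R * Theta i 0 = p%:~R) ->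
  exists Theta1 (rho1 : R) (q1 : nat),
    [/\ 0 < rho1, rho1 <= rho / 2, mx_close (rho / 2) Theta Theta1, (q < q1)%N &
    (forall i, exists p : int, q1%:R * Theta1 i 0 = p%:~R) /\
    exists2 eta, eta < rho & forall Theta', mx_close rho1 Theta1 Theta' ->
    [/\ g Theta' != 0, forall i, near_int eta (q%:R * Theta' i 0) &
      forall x : 'cV[int]_m.+1, (forall j, (`|x j 0%R| <= q1)%N) ->
        (exists2 j : 'I_m.+1, j != 0 & x j 0 != 0) ->
        exists i, ~~ near_int eta ((Theta' *m intv R x) i 0)]].
Proof.
move=> g_ex g_poly g_open rho0 q0 /choice[p pE].
have [D [w [k [k0 Dw gD]]]] := exists_shift_rational Theta g_ex g_open.
have [e1 e10 He1] : exists2 e : R, 0 < e &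
    forall t, 0 < t < e -> g (Theta + t *: D) != 0.
  have [P PE] := g_poly Theta D.
  have [|e e0 He] := @poly_neq0_near0 R P; first by rewrite PE scale1r.
  by exists e => // t /He; rewrite PE.
pose A := \sum_i \sum_j `|D i j|.
have A0 : 0 <= A by rewrite sumr_ge0// => i _; rewrite sumr_ge0.
have DA i j : `|D i j| <= A.
  rewrite /A (bigD1 i)//= (bigD1 j)//= -addrA lerDl addr_ge0//.
    by rewrite sumr_ge0.
  by rewrite sumr_ge0// => i' _; rewrite sumr_ge0.
pose W := (\sum_i `|w i|)%N.
have wW i : (`|w i| <= W)%N by rewrite /W (bigD1 i)//= leq_addr.
(* [q] times the new first column is within [K0 / q1] of an integer point. The other
   columns are first chosen for twice this distance, which leaves room for the
   perturbation that makes [g] nonzero. *)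
pose K0 : R := q%:R ^+ 2 * W%:R + 1.
have K00 : 0 < K0 by rewrite ltr_wpDl// mulr_ge0// exprn_ge0.
pose M := (Num.bound (8 / rho)).+1.
have M_rho : M%:R^-1 <= rho / 8.
  rewrite invf_ple ?posrE ?divr_gt0// invf_div ltW//.
  by rewrite (lt_trans (archi_boundP _)) ?ltr_nat// divr_ge0// ltW.
have [Q0 HQ0] := @exists_badly_approximable R n m M (2 * K0) mn isT
  (mulr_ge0 (ler0n _ 2) (ltW K00)).
have [b1 b1P] : exists b : nat, e1^-1 < b%:R.
  exists (Num.bound e1^-1); apply: archi_boundP.
  by rewrite invr_ge0; apply: ltW.
have [b2 b2P] : exists b : nat, 8 * A / rho < b%:R.
  by exists (Num.bound (8 * A / rho)); apply: archi_boundP; rewrite divr_ge0 ?mulr_ge0 ?(ltW rho0).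
have [b3 b3P] : exists b : nat, K0 / rho < b%:R.
  by exists (Num.bound (K0 / rho)); apply: archi_boundP; rewrite divr_ge0 ?ltW.
(* In turn these bounds ensure [q < q1], the hypothesis [Q0 <= q1], [g] nonzero at [Theta + D / N],
   a displacement of at most [rho / 8], and [K0 / q1 < rho]. *)
have [N [N2 NQ0 Nb1 Nb2 Nb3]] : exists N, [/\ (1 < N)%N, (Q0 <= N)%N,
    (b1 <= N)%N, (b2 <= N)%N & (b3 <= N)%N].
  by exists (2 + Q0 + b1 + b2 + b3)%N; split; lia.
have N0 : (0 < N)%N by exact: ltnW N2.
have N0R : 0 < N%:R :> R by rewrite ltr0n.
have N_e1 : N%:R^-1 < e1.
  by rewrite invf_plt ?posrE// (lt_le_trans b1P)// ler_nat.
have N_A : N%:R^-1 * A <= rho / 8.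
  rewrite mulrC ler_pdivrMr// -ler_pdivrMl ?divr_gt0// invf_div.
  rewrite mulrAC; apply/ltW/(lt_le_trans b2P).
  by rewrite ler_nat.
(* [q] clears the denominators of the first column of [Theta], and [k * N] those of [D / N]. *)
pose q1 := (k * N * q)%N.
have Nq1 : (N <= q1)%N by rewrite /q1 mulnAC leq_pmull// muln_gt0 k0.
have q10 : (0 < q1)%N by rewrite !muln_gt0 k0 N0.
have q10R : 0 < q1%:R :> R by rewrite ltr0n.
have K_rho : K0 / q1%:R < rho.
  rewrite ltr_pdivrMr// mulrC -ltr_pdivrMr//.
  apply: lt_le_trans b3P _.
  by rewrite ler_nat (leq_trans Nb3).
have qq1 : (q < q1)%N by rewrite ltn_Pmull// (@leq_trans N)// leq_pmull.
pose ThN := Theta + N%:R^-1 *: D.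
have gN : g ThN != 0 by apply: He1; rewrite invr_gt0 N0R.
have ThN_close : mx_close (rho / 8) Theta ThN.
  move=> i j; rewrite !mxE addrAC subrr add0r normrM gtr0_norm ?invr_gt0//.
  by apply: le_trans N_A; rewrite ler_wpM2l// invr_ge0.
have ThN0 i : q%:R * ThN i 0 = (p i)%:~R + q%:R ^+ 2 * (w i)%:~R / q1%:R.
  rewrite !mxE mulrDr pE Dw /q1 !natrM; congr (_ + _); field.
  by rewrite !pnatr_eq0 -!lt0n ?k0 ?N0 ?q0.
have [|Thb [Thb0 Thb_close Thb_far]] := HQ0 q1 _ ThN; first by rewrite (leq_trans NQ0).
(* On the segment from [Thb] to [ThN] the first column is constant, and [g] is nonzero at the end
   [ThN], hence close to the end [Thb]. *)
have [e2 e20 He2] : exists2 e : R, 0 < e &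
    forall t, 0 < t < e -> g (Thb + t *: (ThN - Thb)) != 0.
  have [P PE] := g_poly Thb (ThN - Thb).
  have [|e e0 He] := @poly_neq0_near0 R P; first by rewrite PE scale1r addrC subrK.
  by exists e => // t /He; rewrite PE.
(* A perturbation of size [2 * tau] moves each coordinate of [Theta x], for [|x| <= q1], by at most
   [1 / q1 <= K0 / q1]. *)
pose tau : R := (2 * m.+1%:R * q1%:R ^+ 2)^-1.
have tau0 : 0 < tau by rewrite invr_gt0 !mulr_gt0// exprn_gt0.
pose t := Num.min (Num.min 1 (e2 / 2)) (tau / rho).
have t0 : 0 < t by rewrite !lt_min ltr01 !divr_gt0.
have t1 : t <= 1 by rewrite !ge_min lexx.
have te2 : t < e2.
  apply: (@le_lt_trans _ _ (e2 / 2)); first by rewrite !ge_min lexx !orbT.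
  by lra.
have t_tau : t * rho <= tau.
  by rewrite -ler_pdivlMr// !ge_min lexx !orbT.
pose Th1 := Thb + t *: (ThN - Thb).
have g1 : g Th1 != 0 by apply: He2; rewrite t0.
have Th1_b i j : `|Th1 i j - Thb i j| <= t * (rho / 8).
  have -> : Th1 i j - Thb i j = t * (ThN i j - Thb i j).
    by rewrite /Th1; clear; move: ThN => Z; rewrite !mxE; ring.
  rewrite normrM gtr0_norm// ler_wpM2l ?(ltW t0)//.
  by rewrite distrC; apply: le_trans (Thb_close i j) M_rho.
have Th10 i : Th1 i 0 = ThN i 0 by rewrite !mxE Thb0 !mxE subrr mulr0 addr0.
have [e3 e30 He3] := g_open _ g1.
pose rho1 := Num.min (Num.min e3 (rho / 2)) tau.
exists Th1, rho1, q1; split=> //.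
- by rewrite !lt_min e30 divr_gt0.
- by rewrite !ge_min lexx !orbT.
- move=> i j.
  have := Th1_b i j; have := Thb_close i j; have := ThN_close i j.
  have : t * (rho / 8) <= rho / 8 by rewrite ler_piMl// divr_ge0// ltW.
  rewrite !ler_norml => ? /andP[? ?] /andP[? ?] /andP[? ?].
  by apply/andP; split; lra.
split.
  move=> i; exists ((k * N)%:Z * p i + q%:Z * w i).
  rewrite Th10 intrD !intrM -!pmulrn -pE /q1 !natrM !mxE Dw.
  by field; rewrite !pnatr_eq0 -!lt0n ?k0 ?N0 ?q0.
exists (K0 / q1%:R) => // T' T'1.
have rho1_tau : rho1 <= tau by rewrite !ge_min lexx !orbT.
split.
- apply: He3 => i j; apply: le_trans (T'1 i j) _.
  by rewrite !ge_min lexx.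
(* The displacement costs at most [q^2 W / q1] and the perturbation at most [q / q1^2 <= 1 / q1];
   together they give [K0 / q1]. *)
- move=> i; apply/asboolP; exists (p i).
  have -> : q%:R * T' i 0 - (p i)%:~R = q%:R * (T' i 0 - Th1 i 0) +
      q%:R ^+ 2 * (w i)%:~R / q1%:R.
    by rewrite Th10 mulrBr ThN0; ring.
  rewrite /K0 mulrDl [leRHS]addrC; apply: le_trans (ler_normD _ _) (lerD _ _).
    rewrite normrM ger0_norm// mul1r.
    apply: le_trans (ler_wpM2l _ (le_trans (T'1 i 0) rho1_tau)) _ => //.
    have tau_q1 : tau <= q1%:R^-1 * q1%:R^-1.
      rewrite /tau -invfM -expr2 lef_pV2 ?posrE ?mulr_gt0 ?exprn_gt0//.
      by rewrite ler_peMl ?exprn_ge0// -natrM ler1n.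
    apply: le_trans (ler_wpM2l _ tau_q1) _ => //.
    rewrite mulrA ler_piMl ?invr_ge0// ler_pdivrMr// mul1r ler_nat.
    exact: ltnW.
  rewrite normrM [ `|q1%:R^-1|]ger0_norm ?invr_ge0// ler_wpM2r ?invr_ge0//.
  rewrite normrM ger0_norm ?exprn_ge0// ler_wpM2l ?exprn_ge0//.
  by rewrite -intr_norm -abszE -pmulrn ler_nat.
move=> x xq1 /(Thb_far _ xq1)[i hi]; exists i.
apply: not_near_int_perturb xq1 _ hi => [j|].
  have -> : T' i j - Thb i j = (T' i j - Th1 i j) + (Th1 i j - Thb i j) by ring.
  apply: le_trans (ler_normD _ _) (lerD (T'1 i j) (Th1_b i j)).
have : rho1 + t * (rho / 8) <= 2 * tau.
  have : 0 <= t * rho by rewrite mulr_ge0 ?ltW.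
  by lra.
move: (rho1 + _) => z hz.
apply: (@le_trans _ _ (K0 / q1%:R + m.+1%:R * (2 * tau * q1%:R))).
  by rewrite lerD2l ler_wpM2l// ler_wpM2r.
have -> : m.+1%:R * (2 * tau * q1%:R) = q1%:R^-1.
  rewrite /tau; move: (m.+1%:R) (pnatr_eq0 R m.+1) (gt_eqF q10R) => u u0 q1n0.
  by field; rewrite u0 q1n0.
rewrite -mulrA mulr_natl mulr2n lerD2l ler_peMl ?invr_ge0//.
by rewrite /K0 lerDr mulr_ge0// exprn_ge0.
Qed.
End Step.

Lemma nested_intervals (R : realType) (a b : nat -> R) :
  (forall k, a k <= a k.+1) -> (forall k, b k.+1 <= b k) ->
  (forall k, a k <= b k) -> exists x, forall k, a k <= x <= b k.
Proof.
move=> ha hb ab.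
have {}ha : {homo a : i j / (i <= j)%N >-> i <= j}.
  exact/nondecreasing_seqP.
have {}hb : {homo b : i j / (i <= j)%N >-> j <= i}.
  exact/nonincreasing_seqP.
have ub l : ubound (range a) (b l).
  move=> _ [k _ <-]; apply: (@le_trans _ _ (a (maxn k l))).
    by apply: ha; apply: leq_maxl.
  by apply: le_trans (ab _) _; apply: hb; apply: leq_maxr.
exists (sup (range a)) => k; apply/andP; split.
  by apply: ub_le_sup; [exists (b 0%N); apply: ub|exists k].
by apply: ge_sup; [exists (a 0%N), 0%N|apply: ub].
Qed.

(** [exists_step] is iterated along an enumeration of integer matrices. Since radius and
    displacement are each at most half the old radius, the balls are nested, and [Theta] is a common
    point. *)
Lemma exists_theta (R : realType) (n m : nat) : (m.+1 < n)%N ->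
  exists (Theta : 'M[R]_(n, m.+1)) (q : nat -> nat) (eta : nat -> R),
  [/\ forall k, (0 < q k < q k.+1)%N,
      forall e, 0 < e -> exists k, eta k < e,
      forall B, full_col_rank R B -> graph_det B Theta != 0,
      forall k i, near_int (eta k) ((q k)%:R * Theta i 0) &
      forall k (x : 'cV[int]_m.+1), (forall j, (`|x j 0%R| <= q k.+1)%N) ->
        (exists2 j : 'I_m.+1, j != 0 & x j 0 != 0) ->
        exists i, ~~ near_int (eta k) ((Theta *m intv R x) i 0)].
Proof.
move=> mn.
(* Codes of no matrix, or of one without full column rank, get the constant 1, so that every [g k]
   satisfies the hypotheses of [exists_step]. *)
pose g k (T : 'M[R]_(n, m.+1)) : R :=
  if (unpickle k : option 'M[int]_(m.+1 + n, n)) is Some B then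
    if `[< full_col_rank R B >] then graph_det B T else 1 else 1.
have g_ex k : exists T, g k T != 0.
  rewrite /g; case: unpickle => [B|]; last by exists 0; rewrite oner_neq0.
  by case: asboolP => [/exists_graph_det_neq0//|_]; exists 0; rewrite oner_neq0.
have cst1 T D : exists p : {poly R}, forall t : R,
    p.[t] = (fun _ : 'M[R]_(n, m.+1) => 1) (T + t *: D).
  by exists 1 => t; rewrite hornerE.
have g_poly k T D : exists p : {poly R}, forall t, p.[t] = g k (T + t *: D).
  rewrite /g; case: unpickle => [B|]; last exact: cst1.
  by case: asboolP => _; [exact: graph_det_line|exact: cst1].
have g_open k T : g k T != 0 ->
    exists2 e, 0 < e & forall T', mx_close e T T' -> g k T' != 0.
  rewrite /g; case: unpickle => [B|_]; last by exists 1 => // *; rewrite oner_neq0.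
  case: asboolP => _ h; first exact: graph_det_neq0_near.
  by exists 1 => // *; rewrite oner_neq0.
(* A state is a centre, a radius and a common denominator of the first column of the centre. *)
pose St := ('M[R]_(n, m.+1) * R * nat)%type.
pose ok (s : St) := [/\ 0 < s.1.2, (0 < s.2)%N &
  forall i, exists p : int, s.2%:R * s.1.1 i 0 = p%:~R].
pose good_step k (s s' : St) (eta : R) := [/\ s'.1.2 <= s.1.2 / 2,
    mx_close (s.1.2 / 2) s.1.1 s'.1.1, (s.2 < s'.2)%N, eta < s.1.2 &
    forall T', mx_close s'.1.2 s'.1.1 T' ->
    [/\ g k T' != 0, forall i, near_int eta (s.2%:R * T' i 0) &
      forall x : 'cV[int]_m.+1, (forall j, (`|x j 0%R| <= s'.2)%N) ->
        (exists2 j : 'I_m.+1, j != 0 & x j 0 != 0) ->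
        exists i, ~~ near_int eta ((T' *m intv R x) i 0)]].
(* Validity is a premise under the existential, so that [choice] gives a total step function. *)
have fex (ks : nat * St) : exists se : St * R, ok ks.2 ->
    ok se.1 /\ good_step ks.1 ks.2 se.1 se.2.
  case: ks => k [[T rho] q].
  have [[/= rho0 q0 pT]|nok] := pselect (ok (T, rho, q)); last first.
    by exists ((T, rho, q), 0) => /nok.
  have [T1 [rho1 [q1 [? ? ? qq1 [? [eta ? ?]]]]]] :=
    exists_step mn (g_ex k) (g_poly k) (g_open k) rho0 q0 pT.
  exists ((T1, rho1, q1), eta) => _; split; split=> //=.
  exact: leq_ltn_trans qq1.
have [f fP] := choice fex.
pose st := fix st k : St := if k is k'.+1 then (f (k', st k')).1 else (0, 1, 1%N).
have st_ok k : ok (st k).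
  elim: k => [|k IH]; last exact: (fP (k, st k) IH).1.
  by split=> //= i; exists 0; rewrite mxE mulr0.
pose eta k := (f (k, st k)).2.
have stP k : good_step k (st k) (st k.+1) (eta k) := (fP (k, st k) (st_ok k)).2.
pose T k := (st k).1.1; pose rho k := (st k).1.2; pose q k := (st k).2.
have [ Theta ThetaP] : exists Theta : 'M[R]_(n, m.+1), forall k, mx_close (rho k) (T k) Theta.
  have H i j : exists x, forall k, T k i j - rho k <= x <= T k i j + rho k.
    apply: nested_intervals => k.
    - have [h1 /(_ i j) h2 _ _ _] := stP k; move: h1 h2.
      by rewrite -/(rho k) -/(rho k.+1) -/(T k) -/(T k.+1) ler_norml => h1 /andP[]; lra.
    - have [h1 /(_ i j) h2 _ _ _] := stP k; move: h1 h2.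
      by rewrite -/(rho k) -/(rho k.+1) -/(T k) -/(T k.+1) ler_norml => h1 /andP[]; lra.
    - by have [] := st_ok k; rewrite -/(rho k); lra.
  have [F FP] := choice (fun ij : 'I_n * 'I_m.+1 => H ij.1 ij.2).
  exists (\matrix_(i, j) F (i, j)) => k i j; rewrite mxE.
  by have /andP[/= h1 h2] := FP (i, j) k; rewrite ler_norml; apply/andP; split; lra.
have stT k := let: And5 _ _ _ _ h := stP k in h Theta (ThetaP k.+1).
exists Theta, q, eta; split.
- by move=> k; have [_ -> _] := st_ok k; have [_ _ ->] := stP k.
- move=> e e0; exists (Num.bound e^-1).
  have [_ _ _ h _] := stP (Num.bound e^-1); apply: lt_trans h _.
  have rho_le k : rho k <= (2 ^+ k)^-1.
    elim: k => [|k IH]; first by rewrite expr0 invr1.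
    have [h _ _ _ _] := stP k; apply: le_trans h _.
    by rewrite exprSr invfM ler_wpM2r// invr_ge0.
  apply: le_lt_trans (rho_le _) _.
  rewrite invf_plt ?posrE ?exprn_gt0//.
  have ei : 0 <= e^-1 by rewrite invr_ge0 ltW.
  by apply: lt_trans (archi_boundP ei) _; rewrite -natrX ltr_nat ltn_expl.
- move=> B fB; have [] := stT (pickle B).
  by rewrite /g pickleK asboolT.
- by move=> k i; have [_ -> _] := stT k.
- by move=> k x; have [_ _] := stT k; apply.
Qed.

Lemma graph_meet0 (R : realType) (m n : nat) (B : 'M[int]_(m + n, n))
    (Theta : 'M[R]_(n, m)) (x : 'cV[R]_m) (c : 'cV[R]_n) :
  graph_det B Theta != 0 -> x = map_mx intr (usubmx B) *m c ->
  Theta *m x = map_mx intr (dsubmx B) *m c -> x = 0.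
Proof.
rewrite /graph_det -unitfE -unitmxE => U -> e.
suff -> : c = 0 by rewrite mulmx0.
rewrite -[c](mulKmx U) mulmxBl -e mulmxA subrr mulmx0//.
Qed.

(** The factor 2 excludes both integral coordinates of [Theta x], whence positive distances, and
    half-integral ones, whence unique nearest points. *)
Lemma graph_irrational (R : realType) (m n : nat) (Theta : 'M[R]_(n, m)) :
  (forall B, full_col_rank R B -> graph_det B Theta != 0) ->
  forall (x : 'cV[int]_m) (i : 'I_n) (h : int), x != 0 ->
  2 * (Theta *m intv R x) i 0 != h%:~R.
Proof.
move=> irr x i h x0; apply/eqP => e.
(* The columns of [col_mx B1 B2] span the multiples of [(2 x, h e_i)] together with
   the [y]-coordinates other than the [i]-th. *)
pose B1 : 'M[int]_(m, n) := \matrix_(a, b) if b == i then 2 * x a 0 else 0.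
pose B2 : 'M[int]_n := \matrix_(a, b) if a == b then if a == i then h else 1 else 0.
have B1E (c : 'cV[R]_n) a : (map_mx intr B1 *m c) a 0 = 2 * (x a 0)%:~R * c i 0.
  rewrite mxE (bigD1 i)//= big1 ?addr0 => [|b bi].
    by rewrite !mxE eqxx intrM.
  by rewrite !mxE (negbTE bi) mul0r.
have B2E (c : 'cV[R]_n) a : (map_mx intr B2 *m c) a 0 =
    (if a == i then h%:~R else 1) * c a 0.
  rewrite mxE (bigD1 a)//= big1 ?addr0 => [|b bi].
    by rewrite !mxE eqxx; case: eqP.
  by rewrite !mxE eq_sym (negbTE bi) mul0r.
have fB : full_col_rank R (col_mx B1 B2).
  move=> c; rewrite map_col_mx mul_col_mx => /eqP.
  rewrite col_mx_eq0 => /andP[/eqP/colP c1 /eqP/colP c2].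
  have ci : c i 0 = 0.
    have /existsP[a xa] : [exists a, x a 0 != 0].
      rewrite -negb_forall; apply: contra x0 => /forallP h0.
      by apply/eqP/colP => a; rewrite mxE; apply/eqP.
    move: (c1 a); rewrite B1E mxE => /eqP; rewrite !mulf_eq0 intr_eq0 (negbTE xa).
    by rewrite pnatr_eq0 => /eqP.
  apply/colP => a; rewrite mxE; have [->//|ai] := eqVneq a i.
  by move: (c2 a); rewrite B2E mxE (negbTE ai) mul1r.
have := @graph_meet0 _ _ _ _ Theta (2 *: intv R x)
  (\col_b if b == i then 1 else 2 * (Theta *m intv R x) b 0) (irr _ fB).
rewrite col_mxKu col_mxKd => X.
have : 2 *: intv R x = 0.
  apply: X; apply/colP => a.
    by rewrite B1E !mxE eqxx mulr1.
  by rewrite B2E -scalemxAr !mxE; case: eqP => [->|_]; rewrite ?mulr1 ?mul1r// -e mxE.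
move/eqP; rewrite scaler_eq0 pnatr_eq0/= => /eqP/colP x00.
case/eqP: x0; apply/colP => a; have := x00 a; rewrite !mxE => /eqP.
by rewrite intr_eq0 => /eqP.
Qed.

(** * Rational subspaces and the graph *)

Lemma graph_meet_col_space (R : realType) (m n : nat) (B : 'M[int]_(m + n, n))
    (Theta : 'M[R]_(n, m)) (z : 'cV[R]_(m + n)) (c : 'cV[R]_n) :
  graph_det B Theta != 0 -> graph_subspace Theta z -> z = map_mx intr B *m c ->
  z = 0.
Proof.
move=> dB zG; rewrite -{1}[B]vsubmxK map_col_mx mul_col_mx => zE.
have z0 : usubmx z = 0.
  by apply: (graph_meet0 (c := c) dB); rewrite -?zG zE ?col_mxKu ?col_mxKd.
by rewrite -[z]vsubmxK zG z0 mulmx0 col_mx0.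
Qed.

Lemma mulmx_sum_col_cV (R : realType) (k n : nat) (A : 'M[R]_(k, n)) (c : 'cV[R]_n) :
  A *m c = \sum_j c j 0 *: col j A.
Proof.
apply/colP => i; rewrite mxE summxE; apply: eq_bigr => j _.
by rewrite !mxE mulrC.
Qed.

(** A lattice basis of [V] consists of integer vectors; as columns they form a [B] of full rank
    whose column space is [V]. *)
Lemma graph_completely_irrational (R : realType) (m n : nat) (Theta : 'M[R]_(n, m)) :
  (forall B, full_col_rank R B -> graph_det B Theta != 0) ->
  completely_irrational Theta.
Proof.
move=> irr V; rewrite /rational_subspace => rV dV; move: rV; rewrite dV.
move=> [b [fb Vb]].
have bV (j : 'I_n) : exists a, b`_j \in V /\ intv R a = b`_j.
  have : ([set` V] `&` range (@intv R _))%classic b`_j.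
    rewrite Vb; exists (fun i => (i == j)%:Z) => //.
    rewrite (bigD1 j)//= eqxx scale1r big1 ?addr0// => i /negbTE ->.
    by rewrite scale0r.
  by move=> [Vj [a _ aE]]; exists a.
have [a aP] := choice bV.
pose B := \matrix_(r, j) a j r 0.
have BE c : map_mx intr B *m c = \sum_j c j 0 *: b`_j.
  rewrite mulmx_sum_col_cV; apply: eq_bigr => j _; congr (_ *: _).
  by rewrite -(aP j).2; apply/colP => r; rewrite !mxE.
have fB : full_col_rank R B.
  move=> c; rewrite BE; move/freeP: fb => /[apply] c0.
  by apply/colP => j; rewrite c0 mxE.
apply/seteqP; split => [z [zG zV]|_ ->]; last first.
  by split; [rewrite /graph_subspace/= !linear0|exact: mem0v].
have bas : basis_of V b.
  rewrite basisEfree fb size_tuple dV leqnn andbT/=.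
  apply/span_subvP => x /(nthP 0)[j]; rewrite size_tuple => jn <-.
  exact: (aP (Ordinal jn)).1.
apply: (graph_meet_col_space (c := \col_j coord b j z) (irr _ fB) zG).
rewrite BE {1}(coord_basis bas zV); apply: eq_bigr => j _.
by rewrite mxE.
Qed.

Definition in_col_space (R : realType) (k r : nat) (B : 'M[int]_(k, r))
    (z : 'cV[R]_k) : Prop :=
  exists c : 'cV[R]_r, z = map_mx intr B *m c.

Lemma full_col_rank_row_mx (R : realType) (k r : nat) (B : 'M[int]_(k, r))
    (v : 'cV[int]_k) :
  full_col_rank R B -> ~ in_col_space B (intv R v) ->
  full_col_rank R (row_mx B v).
Proof.
move=> fB vB c; rewrite -[c]vsubmxK map_row_mx mul_row_col.
set c1 := usubmx c; set c2 := dsubmx c => e.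
have e' : map_mx intr B *m c1 = - (c2 0 0 *: intv R v).
  apply/eqP; rewrite -addr_eq0 -e; apply/eqP; congr (_ + _).
  by rewrite [c2 in RHS]mx11_scalar mul_mx_scalar.
have [c20|c20] := eqVneq (c2 0 0) 0.
  rewrite c20 scale0r oppr0 in e'; rewrite (fB _ e').
  by rewrite (mx11_scalar c2) c20 raddf0 col_mx0.
case: vB; exists (- (c2 0 0)^-1 *: c1); rewrite -scalemxAr e' scalerN scaleNr.
by rewrite opprK scalerA mulVf// scale1r.
Qed.

Lemma in_col_space_row_mx (R : realType) (k r s : nat) (B : 'M[int]_(k, r))
    (B' : 'M[int]_(k, s)) (z : 'cV[R]_k) :
  in_col_space B z -> in_col_space (row_mx B B') z.
Proof.
move=> [c ->]; exists (col_mx c 0).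
by rewrite map_row_mx mul_row_col mulmx0 addr0.
Qed.

(** With fewer than [k] columns, some unit vector lies outside the column space and can be
    adjoined. *)
Lemma extend_col_rank (R : realType) (k n r : nat) (B : 'M[int]_(k, r)) :
  full_col_rank R B -> (r <= n <= k)%N ->
  exists B' : 'M[int]_(k, n), full_col_rank R B' /\
    forall z : 'cV[R]_k, in_col_space B z -> in_col_space B' z.
Proof.
move=> fB /andP[rn nk]; have [s ns] : exists s, n = (r + s)%N.
  by exists (n - r)%N; rewrite subnKC.
elim: s r B fB rn ns => [|s IH] r B fB rn ns.
  by rewrite addn0 in ns; subst r; exists B.
have [i Bi] : exists i, ~ in_col_space B (intv R (delta_mx i 0)).
  apply: contrapT => /forallNP h.
  have {}h i : in_col_space B (intv R (delta_mx i 0)) by apply: contrapT.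
  have [c cP] := choice h.
  have e : map_mx intr B *m (\matrix_(a, b) c b a 0) = 1%:M :> 'M[R]_k.
    apply/matrixP => a b; have /colP/(_ a) := cP b.
    rewrite !mxE eqxx andbT => E.
    have -> : (a == b)%:R = ((a == b)%:R : int)%:~R :> R by case: eqP.
    rewrite E.
    by apply: eq_bigr => j _; rewrite !mxE.
  have : (\rank (1%:M : 'M[R]_k) <= r)%N.
    by rewrite -e (leq_trans (mxrankM_maxl _ _))// rank_leq_col.
  by rewrite mxrank1 ns in nk *; lia.
have [|||B' [fB' B'P]] := IH (r + 1)%N (row_mx B (delta_mx i 0)).
- exact: full_col_rank_row_mx.
- lia.
- lia.
by exists B'; split=> // z /(in_col_space_row_mx (delta_mx i 0)) /B'P.
Qed.

(** Columns are drawn greedily from the points [Z nu], each outside the span of the previous ones.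
    Either [n] of them are found, and they span [V] because [\dim V <= n], or all points are already
    in the span, and unit vectors complete it. *)
Lemma exists_integer_basis (R : realType) (k n : nat) (V : {vspace 'cV[R]_k})
    (Z : nat -> 'cV[int]_k) :
  (\dim V <= n <= k)%N -> (forall nu, intv R (Z nu) \in V) ->
  exists B : 'M[int]_(k, n), full_col_rank R B /\
    forall nu, in_col_space B (intv R (Z nu)).
Proof.
move=> /andP[dV nk] ZV.
suff: forall s r (B : 'M[int]_(k, r)), n = (r + s)%N -> full_col_rank R B ->
    (forall j, intv R (col j B) \in V) ->
    exists B : 'M[int]_(k, n), full_col_rank R B /\
      forall nu, in_col_space B (intv R (Z nu)).
  move=> /(_ n 0%N 0); apply=> //; last by case.
  by move=> c _; apply/colP => -[].
elim=> [|s IH] r B nr fB BV.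
  rewrite addn0 in nr; subst r; exists B; split=> // nu.
  pose b := [tuple intv R (col j B) | j < n].
  have bE (j : 'I_n) : b`_j = intv R (col j B).
    by rewrite -tnth_nth tnth_mktuple.
  have BE c : map_mx intr B *m c = \sum_j c j 0 *: b`_j.
    rewrite mulmx_sum_col_cV; apply: eq_bigr => j _.
    by rewrite bE /intv map_col.
  have fb : free b.
    apply/freeP => c e j; have : map_mx intr B *m (\col_j c j) = 0.
      by rewrite BE -[RHS]e; apply: eq_bigr => i _; rewrite mxE.
    by move=> /fB /colP/(_ j); rewrite !mxE.
  have bas : basis_of V b.
    rewrite basisEfree fb size_tuple dV andbT/=.
    apply/span_subvP => x /(nthP 0)[j]; rewrite (size_tuple b) => jn <-.
    by rewrite (bE (Ordinal jn)).
  exists (\col_j coord b j (intv R (Z nu))).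
  rewrite BE {1}(coord_basis bas (ZV nu)); apply: eq_bigr => j _.
  by rewrite mxE.
have [h|/existsNP[nu Znu]] := pselect (forall nu, in_col_space B (intv R (Z nu))).
  have [|B' [fB' B'P]] := @extend_col_rank R k n r B fB.
    by rewrite nk nr leq_addr.
  by exists B'; split=> // nu; apply: B'P.
apply: (IH (r + 1)%N (row_mx B (Z nu))); first by rewrite nr; lia.
  exact: full_col_rank_row_mx.
move=> j; rewrite -[j]splitK; case: (fintype.split j) => i /=.
  by rewrite colKl.
by rewrite colKr col_id.
Qed.

(** * Best approximations *)

Lemma norm_cV_le (R : realType) (k : nat) (x : 'cV[R]_k) (d : R) :
  0 <= d -> (forall i, `|x i 0| <= d) -> `|x| <= d.
Proof.
move=> d0 xd; rewrite [leLHS]/Num.Def.normr/= mx_normrE.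
by rewrite bigmax_le// => -[i j] _ /=; rewrite (ord1 j).
Qed.

Lemma le_norm_cV (R : realType) (k : nat) (x : 'cV[R]_k) (i : 'I_k) :
  `|x i 0| <= `|x|.
Proof.
rewrite [leRHS]/Num.Def.normr/= mx_normrE.
by rewrite (le_bigmax _ (fun ij => `|x ij.1 ij.2|) (i, 0)).
Qed.

(** The sup-norm as a natural number, so that least values and enumerations are available. *)
Definition sup_norm (k : nat) (x : 'cV[int]_k) : nat := \max_i `|x i 0%R|%N.

Lemma sup_norm_leP (k : nat) (x : 'cV[int]_k) (Q : nat) :
  reflect (forall i, (`|x i 0%R| <= Q)%N) (sup_norm x <= Q)%N.
Proof.
by apply: (iffP (bigmax_leqP _ _ _)) => h i => [|_]; apply: h.
Qed.

Lemma norm_intv (R : realType) (k : nat) (x : 'cV[int]_k) :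
  `|intv R x| = (sup_norm x)%:R.
Proof.
have E i : `|intv R x i 0| = (`|x i 0%R|%N)%:R.
  by rewrite mxE -intr_norm -abszE -pmulrn.
apply/eqP; rewrite eq_le; apply/andP; split.
  by apply: norm_cV_le => // i; rewrite E ler_nat; apply/sup_norm_leP.
have [i0|k0] := pickP 'I_k; last first.
  rewrite (_ : sup_norm x = 0%N) ?normr_ge0//.
  by apply/eqP; rewrite -leqn0; apply/sup_norm_leP => i; have := k0 i.
have k_gt0 : (0 < #|'I_k|)%N by apply/card_gt0P; exists i0.
have [i hi] := @bigop.eq_bigmax 'I_k (fun i => `|x i 0%R|%N) k_gt0.
by rewrite /sup_norm hi -E le_norm_cV.
Qed.

Lemma sup_normN (k : nat) (x : 'cV[int]_k) : sup_norm (- x) = sup_norm x.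
Proof. by apply: eq_bigr => i _; rewrite mxE abszN. Qed.

Lemma dist_int_le (R : realType) (k : nat) (xi : 'cV[R]_k) a :
  dist_int xi <= `|xi - intv R a|.
Proof.
by apply: ge_inf; [exists 0 => _ [b _ <-]; exact: normr_ge0|exists a].
Qed.

Lemma dist_int_leP (R : realType) (k : nat) (xi : 'cV[R]_k) (d : R) : 0 <= d ->
  reflect (forall i, near_int d (xi i 0)) (dist_int xi <= d).
Proof.
move=> d0; apply: (iffP idP) => [h i|h].
  have [a aE] := dist_int_attained xi; apply/asboolP; exists (a i 0).
  apply: le_trans h; rewrite aE; apply: le_trans (le_norm_cV _ i).
  by rewrite !mxE.
have {}h i : exists y : int, `|xi i 0 - y%:~R| <= d by apply/asboolP/h.
have [y yP] := choice h.
apply: le_trans (dist_int_le _ (\col_i y i)) _.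
by apply: norm_cV_le => // i; rewrite !mxE.
Qed.

Lemma dist_int_le_half (R : realType) (k : nat) (xi : 'cV[R]_k) :
  dist_int xi <= 2^-1.
Proof.
apply/dist_int_leP; first by rewrite invr_ge0.
move=> i; have [a aP] := nearest_int (xi i 0); apply/asboolP; exists a.
(* Minimality against the two neighbours of [a] already forces distance at most 1/2. *)
move: (aP (a + 1)) (aP (a - 1)).
have -> : (a + 1)%:~R = a%:~R + 1 :> R by rewrite intrD.
have -> : (a - 1)%:~R = a%:~R - 1 :> R by rewrite intrB.
by do 3 case: ger0P => ?; lra.
Qed.

Lemma dist_intN (R : realType) (k : nat) (xi : 'cV[R]_k) :
  dist_int (- xi) = dist_int xi.
Proof.
have le (u : 'cV[R]_k) : dist_int (- u) <= dist_int u.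
  have [a ->] := dist_int_attained u; apply: le_trans (dist_int_le _ (- a)) _.
  by rewrite /intv map_mxN -opprD normrN.
by apply/eqP; rewrite eq_le le -{1}[xi]opprK le.
Qed.

(** Each term is the least element of [P] beyond the previous one, so none is skipped. *)
Lemma infinite_enum (P : nat -> Prop) : (forall k, exists2 v, (k <= v)%N & P v) ->
  exists u : nat -> nat, [/\ forall k, P (u k), forall k, (u k < u k.+1)%N &
    forall v, P v -> exists k, u k = v].
Proof.
move=> infP.
have nextP k : exists v, [/\ (k <= v)%N, P v &
    forall v', (k <= v')%N -> P v' -> (v <= v')%N].
  have ex : exists v, (k <= v)%N && `[< P v >].
    by have [v kv Pv] := infP k; exists v; rewrite kv asboolT.
  case: (ex_minnP ex) => v /andP[kv /asboolP Pv] vmin; exists v; split=> // v' kv' Pv'.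
  by apply: vmin; rewrite kv' asboolT.
have [f fP] := choice nextP.
pose u := fix u k := if k is k'.+1 then f (u k').+1 else f 0%N.
have uS k : (u k < u k.+1)%N by have [] := fP (u k).+1.
have uk k : (k <= u k)%N.
  by elim: k => // k IH; apply: leq_ltn_trans (uS k).
exists u; split=> // [[|k]|v Pv]; [by have [] := fP 0%N|by have [] := fP (u k).+1|].
have ex : exists k, (v <= u k)%N by exists v.
case: (ex_minnP ex) => k vk kmin; exists k; apply/eqP.
rewrite eqn_leq vk andbT; case: k kmin {vk} => [|k] kmin.
  by have [_ _ h] := fP 0%N; apply: h.
have [_ _ h] := fP (u k).+1; apply: h => //.
by rewrite ltnNge; apply/negP => /kmin; rewrite ltnn.
Qed.

(** If the sequences agree before [k], the [k]-th term of each occurs in the other at an index at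
    least [k], which gives both inequalities. *)
Lemma strict_enum_unique (u v : nat -> nat) :
  (forall k, (u k < u k.+1)%N) -> (forall k, (v k < v k.+1)%N) ->
  (forall k, exists j, v j = u k) -> (forall k, exists j, u j = v k) -> u =1 v.
Proof.
move=> /(homo_ltn ltn_trans) uS /(homo_ltn ltn_trans) vS uv vu k.
have leW (w : nat -> nat) : {homo w : i j / (i < j)%N} -> {homo w : i j / (i <= j)%N}.
  by move=> h; apply: ltnW_homo.
elim/ltn_ind: k => k IH; apply/eqP; rewrite eqn_leq; apply/andP; split.
  have [j uj] := vu k; rewrite -uj; have [kj|jk] := leqP k j; first exact: leW uS _ _ kj.
  by have := vS _ _ jk; rewrite -uj IH// ltnn.
have [j vj] := uv k; rewrite -vj; have [kj|jk] := leqP k j; first exact: leW vS _ _ kj.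
by have := uS _ _ jk; rewrite -vj -IH// ltnn.
Qed.

Lemma positive_lower_bound (R : realType) (T : eqType) (f : T -> R) (s : seq T) :
  (forall x, x \in s -> 0 < f x) ->
  exists2 e, 0 < e & forall x, x \in s -> e <= f x.
Proof.
elim: s => [|x s IH] h; first by exists 1.
have [|e e0 es] := IH; first by move=> y ys; rewrite h// inE ys orbT.
exists (Num.min (f x) e); first by rewrite lt_min e0 h// mem_head.
by move=> y; rewrite inE ge_min => /orP[/eqP ->|/es ->]; rewrite ?lexx ?orbT.
Qed.

Definition axis (m : nat) (a : nat) : 'cV[int]_m.+1 := a%:Z *: delta_mx 0 0.

Lemma axisE m a (j : 'I_m.+1) : axis m a j 0 = if j == 0 then a%:Z else 0.
Proof. by rewrite !mxE eqxx andbT; case: eqP; rewrite ?mulr1 ?mulr0. Qed.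

Lemma sup_norm_axis m a : sup_norm (axis m a) = a.
Proof.
apply/eqP; rewrite eqn_leq; apply/andP; split.
  by apply/sup_norm_leP => j; rewrite axisE; case: eqP.
by have /sup_norm_leP/(_ 0) := leqnn (sup_norm (axis m a)); rewrite axisE eqxx.
Qed.

Lemma mulmx_axis (R : realType) (n m a : nat) (Theta : 'M[R]_(n, m.+1)) i :
  (Theta *m intv R (axis m a)) i 0 = a%:R * Theta i 0.
Proof.
rewrite mxE (bigD1 0)//= mxE axisE eqxx big1 ?addr0; first by rewrite mulrC -pmulrn.
by move=> j j0; rewrite mxE axisE (negbTE j0) mulr0.
Qed.

Lemma collinear_axis m (x : 'cV[int]_m.+1) : (forall j : 'I_m.+1, j != 0 -> x j 0 = 0) ->
  x = axis m (sup_norm x) \/ x = - axis m (sup_norm x).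
Proof.
move=> x0; have xE : sup_norm x = `|x 0%R 0%R|%N.
  apply/eqP; rewrite eqn_leq; apply/andP; split.
    by apply/sup_norm_leP => j; have [->//|/x0 ->] := eqVneq j 0.
  by have /sup_norm_leP/(_ 0) := leqnn (sup_norm x).
have : x 0 0 = `|x 0%R 0%R|%N%:Z \/ x 0 0 = - `|x 0%R 0%R|%N%:Z.
  by move: (x 0 0) => y; lia.
rewrite xE; case=> xa; [left|right]; apply/colP => j.
  by rewrite axisE; have [->|/x0 ->] := eqVneq j 0.
by rewrite mxE axisE; have [->|/x0 ->] := eqVneq j 0; rewrite ?oppr0.
Qed.

(** * Best approximations of the constructed matrix *)

Section Dimension.
Variables (R : realType) (n m : nat) (Theta : 'M[R]_(n, m.+1)).
Variables (q : nat -> nat) (eta : nat -> R).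
Hypothesis mn : (m.+1 < n)%N.
Hypothesis q_incr : forall k, (0 < q k < q k.+1)%N.
Hypothesis eta0 : forall e, 0 < e -> exists k, eta k < e.
Hypothesis irr : forall B, full_col_rank R B -> graph_det B Theta != 0.
Hypothesis near_q : forall k i, near_int (eta k) ((q k)%:R * Theta i 0).
Hypothesis far_q : forall k (x : 'cV[int]_m.+1), (forall j, (`|x j 0%R| <= q k.+1)%N) ->
  (exists2 j : 'I_m.+1, j != 0 & x j 0 != 0) ->
  exists i, ~~ near_int (eta k) ((Theta *m intv R x) i 0).

Let D (x : 'cV[int]_m.+1) : R := dist_int (Theta *m intv R x).

Lemma eta_ge0 k : 0 <= eta k.
Proof.
have n0 : (0 < n)%N by apply: ltn_trans mn.
have /asboolP[y] := near_q k (Ordinal n0).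
exact: le_trans.
Qed.

Lemma dist_q k : D (axis m (q k)) <= eta k.
Proof.
by apply/(dist_int_leP _ (eta_ge0 k)) => i; rewrite mulmx_axis.
Qed.

Lemma dist_far k x : (sup_norm x <= q k.+1)%N ->
  (exists2 j : 'I_m.+1, j != 0 & x j 0 != 0) -> eta k < D x.
Proof.
move=> /sup_norm_leP xq x0; rewrite ltNge; apply/negP.
move=> /(dist_int_leP _ (eta_ge0 k)) h.
by have [i /negP] := far_q xq x0; apply.
Qed.

(** Take [q k] with [q k <= |x| < q k.+1]: its distance is at most [eta k], while that of [x]
    exceeds it. *)
Lemma exists_closer_axis x : (q 0 <= sup_norm x)%N ->
  (exists2 j : 'I_m.+1, j != 0 & x j 0 != 0) ->
  exists a, [/\ (0 < a)%N, (a <= sup_norm x)%N & D (axis m a) < D x].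
Proof.
move=> qx x0.
have qk k : (k < q k)%N.
  elim: k => [|k IH]; first by have /andP[] := q_incr 0.
  by have /andP[_] := q_incr k; apply: leq_ltn_trans.
have ex : exists k, (sup_norm x < q k)%N by exists (sup_norm x).
case: (ex_minnP ex) => -[|k] xk kmin; first by rewrite ltnNge qx in xk.
exists (q k); split; first by have /andP[] := q_incr k.
  by rewrite leqNgt; apply/negP => /kmin; rewrite ltnn.
by apply: le_lt_trans (dist_q k) (dist_far (ltnW xk) x0).
Qed.

Lemma dist_gt0 x : x != 0 -> 0 < D x.
Proof.
have n0 : (0 < n)%N by apply: ltn_trans mn.
move=> x0; rewrite ltNge; apply/negP => /(dist_int_leP _ (lexx 0)).
move=> /(_ (Ordinal n0)) /asboolP[y]; rewrite normr_le0 subr_eq0 => /eqP e.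
have := graph_irrational irr (Ordinal n0) (2 * y) x0.
by rewrite e intrM eqxx.
Qed.

(** In a coordinate where [y] and [y'] differ, both lie within 1/2 of [t], so [2 * t] is their sum,
    against [graph_irrational]. *)
Lemma nearest_unique x (y y' : 'cV[int]_n) : x != 0 ->
  `|Theta *m intv R x - intv R y| = D x ->
  `|Theta *m intv R x - intv R y'| = D x -> y = y'.
Proof.
move=> x0 yD y'D; apply/colP => i; apply/eqP; apply: contraT => yy'.
set t := (Theta *m intv R x) i 0.
have h (z : 'cV[int]_n) : `|Theta *m intv R x - intv R z| = D x ->
    `|t - (z i 0)%:~R| <= 2^-1.
  move=> zD; apply: le_trans (dist_int_le_half (Theta *m intv R x)).
  by rewrite -/(D x) -zD; apply: le_trans (le_norm_cV _ i); rewrite /t !mxE.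
have := h _ yD; have := h _ y'D; rewrite !ler_norml => /andP[h1 h2] /andP[h3 h4].
have tn (z : int) : 2 * t != z%:~R by exact: graph_irrational.
have yy : (y i 0 + 1 <= y' i 0) || (y' i 0 + 1 <= y i 0) by move/eqP: yy'; lia.
case/orP: yy; rewrite -(ler_int R) intrD => h5.
  have /eqP[] := tn (y i 0 + y' i 0); rewrite intrD; lra.
have /eqP[] := tn (y i 0 + y' i 0); rewrite intrD; lra.
Qed.

Lemma best_approximation_infinite K :
  exists2 x, best_approximation Theta x & (K <= sup_norm x)%N.
Proof.
(* Taking [K'] at least [q 0] makes [exists_closer_axis] available outside the box. *)
pose K' := maxn K (q 0).
pose s := [seq x : 'cV[int]_m.+1 <- int_box m.+1 K' | x != 0].
have [|e e0 es] := @positive_lower_bound R _ D s.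
  by move=> x; rewrite mem_filter => /andP[/dist_gt0].
have {}es x : x != 0 -> (sup_norm x <= K')%N -> e <= D x.
  by move=> x0 /sup_norm_leP xK; apply: es; rewrite mem_filter x0; apply/mem_int_box.
have ex : exists a, (0 < a)%N && (D (axis m a) < e).
  have [k ke] := eta0 e0; exists (q k); have /andP[-> _] := q_incr k.
  exact: le_lt_trans (dist_q k) ke.
have axis_neq0 a : (0 < a)%N -> axis m a != 0.
  move=> a0; apply/eqP => e10; have := sup_norm_axis m a.
  rewrite e10; suff -> : sup_norm (0 : 'cV[int]_m.+1) = 0%N by lia.
  by apply/eqP; rewrite -leqn0; apply/sup_norm_leP => i; rewrite mxE.
case: (ex_minnP ex) => a /andP[a0 ae] amin.
have Ka : (K' < a)%N.
  rewrite ltnNge; apply/negP => aK.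
  by have := es (axis m a) (axis_neq0 _ a0); rewrite sup_norm_axis leNgt ae => /(_ aK).
(* The least [a] whose distance is below [e] is a best approximation. *)
exists (axis m a); last first.
  by rewrite sup_norm_axis ltnW// (leq_ltn_trans _ Ka)// leq_maxl.
split; first exact/eqP/axis_neq0.
move=> x /eqP x0; rewrite !norm_intv sup_norm_axis ler_nat => xa xe xNe.
rewrite -/(D _) -/(D _).
have [xK|Kx] := leqP (sup_norm x) K'; first exact: lt_le_trans (es _ x0 xK).
have [[j j0 xj]|nx] := pselect (exists2 j : 'I_m.+1, j != 0 & x j 0 != 0).
  (* The closer axis point has [b <= a]; for [b < a], minimality of [a] bounds its distance below by
     [e]. *)
  have [||b [b0 bx Db]] := @exists_closer_axis x; [|by exists j|].
    by rewrite (leq_trans _ (ltnW Kx))// leq_maxr.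
  have [ba|ba] : (b < a)%N \/ b = a by lia.
    apply: lt_trans Db; apply: lt_le_trans ae _; rewrite leNgt.
    by apply/negP => be; have := amin b; rewrite b0 be leqNgt ba => /(_ isT).
  by rewrite -ba.
have xE : x = axis m (sup_norm x) \/ x = - axis m (sup_norm x).
  apply: collinear_axis => j j0; apply/eqP; apply: contraT => xj.
  by case: nx; exists j.
have xa' : (sup_norm x < a)%N.
  rewrite ltn_neqAle xa andbT; apply/eqP => E.
  by case: xE; rewrite E.
apply: lt_le_trans ae _; rewrite leNgt; apply/negP => xD.
have : D (axis m (sup_norm x)) < e.
  case: xE => E; first by rewrite -E.
  by rewrite -[axis _ _]opprK -E /D /intv map_mxN mulmxN dist_intN.
move=> h; have := amin (sup_norm x).
by rewrite h (leq_ltn_trans _ Kx)//= leqNgt xa' => /(_ isT).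
Qed.

Lemma best_approximation_eq x y :
  best_approximation Theta x -> best_approximation Theta y ->
  sup_norm x = sup_norm y -> y = x \/ y = - x.
Proof.
move=> [x0 xb] [y0 yb] xy.
have [->|yx] := pselect (y = x); first by left.
have [->|yNx] := pselect (y = - x); first by right.
have := xb y y0; rewrite !norm_intv xy lexx => /(_ isT yx yNx) h1.
have := yb x x0; rewrite !norm_intv xy lexx => /(_ isT).
have xy' : x <> y by move=> /esym.
have xNy : x <> - y by move=> E; apply: yNx; rewrite E opprK.
by move=> /(_ xy' xNy) /(lt_trans h1); rewrite ltxx.
Qed.

Lemma best_approximation_lt x y :
  best_approximation Theta x -> best_approximation Theta y ->
  (sup_norm x < sup_norm y)%N -> D y < D x.
Proof.
move=> [x0 _] [_ yb] xy; apply: yb => //.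
- by rewrite !norm_intv ler_nat ltnW.
- by move=> E; rewrite E ltnn in xy.
- by move=> E; rewrite E sup_normN ltnn in xy.
Qed.

Lemma best_approximation_axis x : best_approximation Theta x ->
  (q 0 <= sup_norm x)%N -> forall j : 'I_m.+1, j != 0 -> x j 0 = 0.
Proof.
move=> [x0 xb] qx j j0; apply/eqP; apply: contraT => xj.
have x' : exists2 j : 'I_m.+1, j != 0 & x j 0 != 0 by exists j.
have [a [a0 ax Da]] := exists_closer_axis qx x'.
have : D x < D (axis m a).
  apply: xb; last 1 first.
  - move=> /colP/(_ j); rewrite axisE (negbTE j0) mxE => /eqP.
    by rewrite eq_sym oppr_eq0 (negbTE xj).
  - by move=> /colP/(_ 0); rewrite axisE mxE/=; lia.
  - by rewrite !norm_intv ler_nat sup_norm_axis.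
  - by move=> /colP/(_ j); rewrite axisE (negbTE j0) => /eqP; rewrite eq_sym (negbTE xj).
by move=> /(lt_trans Da); rewrite ltxx.
Qed.

Lemma sup_norm_seq z : best_approximation_seq Theta z ->
  (forall nu, (sup_norm (usubmx (z nu)) < sup_norm (usubmx (z nu.+1)))%N).
Proof. by move=> [_ h _ _] nu; have := h nu; rewrite !norm_intv ltr_nat. Qed.

(** The norms of best approximations are enumerated in increasing order; since a norm determines its
    best approximation up to sign, none is omitted. *)
Lemma best_approximation_seq_exists : exists z, best_approximation_seq Theta z.
Proof.
have [u [uP uS uE]] := @infinite_enum
  (fun v => exists2 x, best_approximation Theta x & sup_norm x = v)
  (fun K => let: ex_intro2 x xb xK := best_approximation_infinite K in
    ex_intro2 _ _ (sup_norm x) xK (ex_intro2 _ _ x xb erefl)).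
have zex k : exists z : 'cV[int]_(m.+1 + n), extended_best_approximation Theta z /\
    sup_norm (usubmx z) = u k.
  have [x xb xu] := uP k; have [a aE] := dist_int_attained (Theta *m intv R x).
  by exists (col_mx x a); rewrite /extended_best_approximation col_mxKu col_mxKd aE.
have [z zP] := choice zex; exists z; split.
- by move=> k; have [] := zP k.
- by move=> k; rewrite !norm_intv ltr_nat (zP k).2 (zP k.+1).2.
- move=> k; apply: best_approximation_lt; [exact: (zP k).1.1|exact: (zP k.+1).1.1|].
  by rewrite (zP k).2 (zP k.+1).2.
- move=> x xb; have [|k uk] := uE (sup_norm x); first by exists x.
  exists k; have [[zb _] zk] := zP k.
  by apply: best_approximation_eq => //; rewrite zk uk.
Qed.

(** Neither sequence omits a best approximation, so both run through the same norms in the same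
    order. The norm fixes [x] up to sign, and [nearest_unique] then fixes [y]. *)
Lemma theta_good : good Theta.
Proof.
have [z zP] := best_approximation_seq_exists; exists z; split=> // z' z'P nu.
have sub z1 z2 : best_approximation_seq Theta z1 -> best_approximation_seq Theta z2 ->
    forall k, exists j, sup_norm (usubmx (z2 j)) = sup_norm (usubmx (z1 k)).
  move=> [h1 _ _ _] [_ _ _ h2] k; have [j H] := h2 _ (h1 k).1.
  by exists j; case: H => ->; rewrite ?sup_normN.
have E : sup_norm (usubmx (z nu)) = sup_norm (usubmx (z' nu)).
  apply: (strict_enum_unique (u := fun k => sup_norm (usubmx (z k)))
    (v := fun k => sup_norm (usubmx (z' k)))).
  - exact: sup_norm_seq.
  - exact: sup_norm_seq.
  - exact: sub.
  - exact: sub.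
have [/(_ nu)[xb xD] _ _ _] := zP; have [/(_ nu)[x'b x'D] _ _ _] := z'P.
have x0 : usubmx (z nu) != 0 by apply/eqP; case: xb.
rewrite -[z nu]vsubmxK -[z' nu]vsubmxK.
case: (best_approximation_eq xb x'b E) => xx'; [left|right].
  rewrite xx' in x'D *; congr col_mx; apply: (nearest_unique x0) => //.
rewrite opp_col_mx xx'; congr col_mx; apply/eqP; rewrite -eqr_oppLR; apply/eqP.
apply: (nearest_unique x0) => //.
have DN : D (usubmx (z nu)) = D (usubmx (z' nu)).
  by rewrite xx' /D /intv map_mxN mulmxN dist_intN.
by rewrite DN -[RHS]x'D xx' /intv !map_mxN mulmxN opprK -opprD normrN.
Qed.

Lemma tail_in_dim_le z : best_approximation_seq Theta z ->
  exists2 s, (s <= n.+1)%N & tail_in_dim R z s.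
Proof.
move=> zP; pose b : seq 'cV[R]_(m.+1 + n) :=
  delta_mx (lshift n 0) 0 :: [seq delta_mx (rshift m.+1 j) 0 | j : 'I_n].
exists (\dim <<b>>); first by rewrite (leq_trans (dim_span _))//= size_map -cardE card_ord.
exists <<b>>%VS; split=> //; exists (q 0) => nu nuq.
have zS := sup_norm_seq zP.
(* Norms increase strictly, so indices from [q 0] on give norms at least [q 0]. *)
have znu k : (k <= sup_norm (usubmx (z k)))%N.
  by elim: k => // k IH; apply: leq_ltn_trans (zS k).
have [/(_ nu)[xb _] _ _ _] := zP.
have x0 := best_approximation_axis xb (leq_trans nuq (znu nu)).
have -> : intv R (z nu) = \sum_i (z nu i 0)%:~R *: delta_mx i 0.
  rewrite [LHS]matrix_sum_delta; apply: eq_bigr => i _.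
  by rewrite big_ord1 mxE.
apply: memv_suml => i _; rewrite -[i]splitK; case: (fintype.split i) => j /=.
  have [->|/x0] := eqVneq j 0; first by rewrite memvZ// memv_span// mem_head.
  by rewrite mxE => ->; rewrite scale0r mem0v.
rewrite memvZ// memv_span// inE; apply/orP; right.
by apply/mapP; exists j; rewrite ?mem_enum.
Qed.

(** On the column space of [B], [x] is a fixed linear image [A *m v] of [v = y - Theta x]. Since [v]
    is bounded along best approximations, a tail in dimension at most [n] would have bounded [x]. *)
Lemma tail_in_dim_ge z s : best_approximation_seq Theta z ->
  tail_in_dim R z s -> (n < s)%N.
Proof.
move=> zP [V [dV [nu0 Vz]]]; rewrite ltnNge; apply/negP => sn.
have [||B [fB BP]] := @exists_integer_basis R (m.+1 + n) n V (fun nu => z (nu0 + nu)%N).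
- by rewrite dV sn leq_addl.
- by move=> nu; apply: Vz; rewrite leq_addr.
have := irr fB; rewrite /graph_det -unitfE -unitmxE.
set M := _ - _ => uM.
pose A := map_mx intr (usubmx B) *m invmx M.
pose C := \sum_a \sum_b `|A a b|.
have bound nu : (sup_norm (usubmx (z (nu0 + nu)%N)))%:R <= C.
  have [c cE] := BP nu; set w := z (nu0 + nu)%N in cE *.
  have xE : intv R (usubmx w) = map_mx intr (usubmx B) *m c.
    by rewrite /intv map_usubmx -/(intv R w) cE -{1}[B]vsubmxK map_col_mx mul_col_mx col_mxKu.
  have yE : intv R (dsubmx w) = map_mx intr (dsubmx B) *m c.
    by rewrite /intv map_dsubmx -/(intv R w) cE -{1}[B]vsubmxK map_col_mx mul_col_mx col_mxKd.
  pose v := intv R (dsubmx w) - Theta *m intv R (usubmx w).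
  have xv : intv R (usubmx w) = A *m v.
    by rewrite /A /v yE xE mulmxA -mulmxBl -mulmxA mulKmx.
  have v1 i : `|v i 0| <= 1.
    apply: le_trans (le_norm_cV _ i) _; rewrite distrC.
    have [/(_ (nu0 + nu)%N)[_ ->] _ _ _] := zP.
    by apply: le_trans (dist_int_le_half _) _; lra.
  rewrite -(norm_intv R) xv; apply: norm_cV_le.
    by rewrite sumr_ge0// => a _; rewrite sumr_ge0.
  move=> a; rewrite /C (bigD1 a)//= mxE; apply: ler_wpDr.
    by rewrite sumr_ge0// => a' _; rewrite sumr_ge0.
  apply: le_trans (ler_norm_sum _ _ _) (ler_sum _ _) => b _.
  by rewrite normrM ler_piMr.
have znu k : (k <= sup_norm (usubmx (z k)))%N.
  elim: k => // k IH; exact: leq_ltn_trans (sup_norm_seq zP k).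
have C0 : 0 <= C by rewrite sumr_ge0// => a _; rewrite sumr_ge0.
have := le_lt_trans (bound (Num.bound C)) (archi_boundP C0).
rewrite ltr_nat ltnNge => /negP; apply.
by apply: leq_trans (znu _); rewrite leq_addl.
Qed.

Lemma best_dim_theta : best_dim Theta = n.+1.
Proof.
have [z zP] := best_approximation_seq_exists.
rewrite (best_dimE theta_good zP) /tail_dim; case: ex_minnP => s /asboolP sP smin.
apply/eqP; rewrite eqn_leq (tail_in_dim_ge zP sP) andbT.
have [t tn tP] := tail_in_dim_le zP.
by apply: leq_trans tn; apply: smin; apply/asboolP.
Qed.

End Dimension.

Theorem theorem1 (R : realType) (m n : nat) (hm : (2 <= m)%N) (hn : (2 <= n)%N)
    (hmn : (m < n)%N) :
  exists Theta : 'M[R]_(n, m),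
    completely_irrational Theta /\ good Theta /\ best_dim Theta = n.+1.
Proof.
case: m hm hmn => // m _ mn.
have [T [q [eta [q_incr eta0 irr near_q far_q]]]] := exists_theta R mn.
exists T; split; first exact: graph_completely_irrational.
by split; [exact: theta_good far_q|exact: best_dim_theta far_q].
Qed.
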